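(* Let $n\in\mathbb{N}$, $(\kappa,k)\in\mathcal{L}_n$ and $\kappa\in C_{-1}^{n-1}(0,+\infty)$. For a function $f\in C_{-1,(k)}^{(1)}(0,+\infty)$, its algebraic general fractional derivative $S_\kappa\cdot f-S_\kappa\cdot(Ff)$ coincides with its general fractional derivative $\mathbb{D}_{(k)}f$ in the Riemann-Liouville sense, i.e. in the field $\mathcal{F}_{-1}$ of convolution quotients $$\mathbb{D}_{(k)}f=S_\kappa\cdot f-S_\kappa\cdot(Ff),$$ where the functions $f$, $\mathbb{D}_{(k)}f$ and $Ff$ are interpreted as elements of the field $\mathcal{F}_{-1}$.
   Context: Functions are (real- or complex-valued, scalar field fixed) functions of $t>0$. $(f*g)(t)=\int_0^t f(t-\tau)g(\tau)\,d\tau$ is the Laplace convolution, and $h_n(t)=t^{n-1}/(n-1)!$ for $n\in\mathbb{N}=\{1,2,\dots\}$. $C_{-1}(0,+\infty)=\{f:\ f(t)=t^pf_1(t),\ t>0,\ p>-1,\ f_1\in C[0,+\infty)\}$. $C_{-1,0}(0,+\infty)=\{f:\ f(t)=t^pf_1(t),\ t>0,\ -1<p<0,\ f_1\in C[0,+\infty)\}$. For $m\in\mathbb{N}_0$, $C_{-1}^m(0,+\infty)=\{f\in C_{-1}(0,+\infty):\ f^{(m)}\in C_{-1}(0,+\infty)\}$ (derivative taken on $(0,+\infty)$). $\mathcal{L}_n$ is the set of pairs $(\kappa,k)$ with $\kappa\in C_{-1}(0,+\infty)$, $k\in C_{-1,0}(0,+\infty)$ and $(\kappa*k)(t)=h_n(t)$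 for all $t>0$. General fractional derivative of Riemann-Liouville type: $(\mathbb{D}_{(k)}f)(t)=\frac{d^n}{dt^n}(k*f)(t)$, $t>0$, with natural domain $C_{-1,(k)}^{(1)}(0,+\infty)=\{f\in C_{-1}(0,+\infty):\ \mathbb{D}_{(k)}f\in C_{-1}(0,+\infty)\}$. Projector operator: $$(Ff)(t)=\sum_{i=0}^{n-1}\left(\frac{d^i}{dt^i}(k*f)\right)(0)\,\frac{d^{\,n-1-i}\kappa}{dt^{\,n-1-i}}(t),\quad t>0,$$ with values at $0$ understood as limits for $t\to0+$; it equals $f-\kappa*(\mathbb{D}_{(k)}f)$ on $C_{-1,(k)}^{(1)}(0,+\infty)$. Known fact: $\mathcal{R}_{-1}=(C_{-1}(0,+\infty),+,* )$ is a commutative ring without zero divisors (and without unity). $\mathcal{F}_{-1}$ is its field of convolution quotients: equivalence classes $\frac fg$ of pairs $(f,g)$, $f,g\in C_{-1}(0,+\infty)$, $g\ne0$, under $(f_1,g_1)\sim(f_2,g_2)\Leftrightarrow f_1*g_2=f_2*g_1$, with $\frac{f_1}{g_1}+\frac{f_2}{g_2}=\frac{f_1*g_2+f_2*g_1}{g_1*g_2}$ and $\frac{f_1}{g_1}\cdot\frac{f_2}{g_2}=\frac{f_1*f_2}{g_1*g_2}$. A function $f\in C_{-1}(0,+\infty)$ is identified with $\frac{f*\kappa}{\kappa}\in\mathcal{F}_{-1}$. The element $S_\kappa=\frac{\kappa}{\kappa*\kappa}\in\mathcal{F}_{-1}$ is the multiplicative inverse of (the image of) $\kappa$. *)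

(* Defs.v *)
From HB Require Import structures.
From mathcomp Require Import all_boot all_order all_algebra.
From mathcomp Require Import complex.
From mathcomp Require Import all_classical all_reals all_analysis.

Set Implicit Arguments.
Unset Strict Implicit.
Unset Printing Implicit Defensive.

Import Order.TTheory GRing.Theory Num.Theory.
Import numFieldNormedType.Exports.

Local Open Scope classical_set_scope.
Local Open Scope ring_scope.
Local Open Scope complex_scope.

(* Functions of t > 0 are maps R -> R[i]; their values at t <= 0 are
   irrelevant, and no definition below depends on them.  Both choices of the
   scalar field are covered at once: for [RealScalars] only functions with
   real values are considered. *)
Variant scalars := RealScalars | ComplexScalars.

Definition is_scalar (R : realType) (K : scalars) (z : R[i]) : Prop :=
  if K is RealScalars then complex.Im z = 0 else True.

Definition Re_fun (R : realType) (f : R -> R[i]) : R -> R :=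
  fun t => complex.Re (f t).

Definition Im_fun (R : realType) (f : R -> R[i]) : R -> R :=
  fun t => complex.Im (f t).

(* The library has no topology, derivative or integral for R[i]-valued
   functions of a real variable: these are taken componentwise. *)
Definition ccontinuous_on (R : realType) (D : set R) (f : R -> R[i]) : Prop :=
  {within D, continuous (Re_fun f)} /\ {within D, continuous (Im_fun f)}.

Definition cderiven (R : realType) (m : nat) (f : R -> R[i]) : R -> R[i] :=
  fun t => derive1n m (Re_fun f) t +i* derive1n m (Im_fun f) t.

(* [derive1n] is total, hence the separate existence predicate: f is m times
   differentiable on (0, +oo). *)
Definition cderivablen (R : realType) (m : nat) (f : R -> R[i]) : Prop :=
  forall (i : nat) (t : R), (i < m)%N -> 0 < t ->
    derivable (derive1n i (Re_fun f)) t 1 /\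
    derivable (derive1n i (Im_fun f)) t 1.

Definition climit0 (R : realType) (f : R -> R[i]) : R[i] :=
  lim (Re_fun f x @[x --> 0^'+]) +i* lim (Im_fun f x @[x --> 0^'+]).

Definition cintegral (R : realType) (D : set R) (f : R -> R[i]) : R[i] :=
  Rintegral lebesgue_measure D (Re_fun f) +i*
  Rintegral lebesgue_measure D (Im_fun f).

Definition lconv (R : realType) (f g : R -> R[i]) : R -> R[i] :=
  fun t => cintegral `]0, t[ (fun tau => f (t - tau) * g tau).

Definition hfun (R : realType) (n : nat) : R -> R[i] :=
  fun t => (t ^+ n.-1 / (n.-1)`!%:R)%:C.

(* f (t) = t ^ p * f1 (t) for t > 0, with f1 in C[0, +oo) *)
Definition power_factor (R : realType) (K : scalars) (p : R) (f : R -> R[i]) :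
    Prop :=
  exists f1 : R -> R[i],
    [/\ ccontinuous_on `[0, +oo[ f1,
        (forall t : R, 0 <= t -> is_scalar K (f1 t)) &
        (forall t : R, 0 < t -> f t = (t `^ p)%:C * f1 t)].

Definition Cm1 (R : realType) (K : scalars) : set (R -> R[i]) :=
  [set f | exists p : R, -1 < p /\ power_factor K p f].

Definition Cm10 (R : realType) (K : scalars) : set (R -> R[i]) :=
  [set f | exists p : R, -1 < p < 0 /\ power_factor K p f].

Definition Cm1_deriv (R : realType) (K : scalars) (m : nat) :
    set (R -> R[i]) :=
  [set f | [/\ Cm1 K f, cderivablen m f & Cm1 K (cderiven m f)]].

Definition Ln (R : realType) (K : scalars) (n : nat) :
    set ((R -> R[i]) * (R -> R[i])) :=
  [set kk | [/\ Cm1 K kk.1, Cm10 K kk.2 &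
    forall t : R, 0 < t -> lconv kk.1 kk.2 t = hfun n t]].

Definition gfd_RL (R : realType) (n : nat) (k f : R -> R[i]) : R -> R[i] :=
  cderiven n (lconv k f).

Definition gfd_RL_domain (R : realType) (K : scalars) (n : nat)
    (k : R -> R[i]) : set (R -> R[i]) :=
  [set f | [/\ Cm1 K f, cderivablen n (lconv k f) & Cm1 K (gfd_RL n k f)]].

Definition projector (R : realType) (n : nat) (kappa k f : R -> R[i]) :
    R -> R[i] :=
  fun t => \sum_(i < n)
    climit0 (cderiven i (lconv k f)) * cderiven (n.-1 - i) kappa t.

(* The field of convolution quotients.  Its elements are equivalence classes,
   i.e. sets, of admissible pairs (numerator, denominator). *)
Definition fpair (R : realType) : Type :=
  ((R -> R[i]) * (R -> R[i]))%type.

Definition cq_pair (R : realType) (K : scalars) : set (fpair R) :=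
  [set q | [/\ Cm1 K q.1, Cm1 K q.2 & exists t : R, 0 < t /\ q.2 t != 0]].

Definition cq_equiv (R : realType) (p q : fpair R) : Prop :=
  forall t : R, 0 < t -> lconv p.1 q.2 t = lconv q.1 p.2 t.

Definition cq_frac (R : realType) (K : scalars) (f g : R -> R[i]) :
    set (fpair R) :=
  [set q | cq_pair K q /\ cq_equiv q (f, g)].

(* An operation on pairs compatible with [cq_equiv] induces an operation on
   classes.  The induced class is the set of the pairs equivalent to the
   results obtained from all representatives; since these results are
   equivalent to each other, it is the class of any one of them. *)
Definition cq_lift1 (R : realType) (K : scalars)
    (op : fpair R -> fpair R) (A : set (fpair R)) : set (fpair R) :=
  [set q | cq_pair K q /\ forall a, A a -> cq_equiv q (op a)].

Definition cq_lift2 (R : realType) (K : scalars)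
    (op : fpair R -> fpair R -> fpair R) (A B : set (fpair R)) :
    set (fpair R) :=
  [set q | cq_pair K q /\ forall a b, A a -> B b -> cq_equiv q (op a b)].

Definition cq_add (R : realType) (K : scalars) :=
  cq_lift2 K (fun a b : fpair R =>
    (fun t => lconv a.1 b.2 t + lconv b.1 a.2 t, lconv a.2 b.2)).

Definition cq_opp (R : realType) (K : scalars) :=
  cq_lift1 K (fun a : fpair R => (fun t => - a.1 t, a.2)).

Definition cq_mul (R : realType) (K : scalars) :=
  cq_lift2 K (fun a b : fpair R => (lconv a.1 b.1, lconv a.2 b.2)).

Definition cq_sub (R : realType) (K : scalars) (A B : set (fpair R)) :
    set (fpair R) :=
  cq_add K A (cq_opp K B).

Definition cq_embed (R : realType) (K : scalars) (kappa f : R -> R[i]) :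
    set (fpair R) :=
  cq_frac K (lconv f kappa) kappa.

Definition cq_S (R : realType) (K : scalars) (kappa : R -> R[i]) :
    set (fpair R) :=
  cq_frac K kappa (lconv kappa kappa).

(* Main.v *)
Require Import Defs.
From mathcomp Require Import all_boot all_order all_algebra.
From mathcomp Require Import complex.
From mathcomp Require Import all_classical all_reals all_analysis.
From mathcomp Require Import measurable_realfun ring lra zify.

Set Implicit Arguments.
Unset Strict Implicit.
Unset Printing Implicit Defensive.

Import Order.TTheory GRing.Theory Num.Theory.
Import numFieldNormedType.Exports.

Local Open Scope classical_set_scope.
Local Open Scope ring_scope.

(** Write [x * y] for the Laplace convolution, [h_m] for [hfun m], and [D f]
    for [gfd_RL n k f].

    The theorem is the identity [f - F f = kappa * D f] on [t > 0], [F] being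
    the projector, divided by [kappa] in the field of quotients.

    The identity itself ([projectorE]) comes from a Taylor expansion.  As
    [D f] is the n-th derivative of [k * f] and is integrable at zero, the
    lower derivatives have limits [c_i] at zero and
    [k * f = \sum_i c_i h_(i+1) + h_n * D f] ([taylor_at0]).  Convolving
    with [kappa], and using [kappa * k = h_n], gives
    [h_n * (f - kappa * D f) = \sum_i c_i (h_(i+1) * kappa)].
    Since [(h_m * y)^(m) = y] ([is_nth_deriv_lconv]), differentiating n times
    turns the left side into [f - kappa * D f] and the right side into
    [\sum_i c_i kappa^(n-1-i)], which is [F f].

    In the field of quotients, both sides are brought to the form [g / kappa],
    and all equivalences of fractions met on the way are decided by cancelling
    [kappa].  That cancellation is elementary
    ([lconv_kappa_inj]): convolving with [k] turns [kappa] into [h_n], which n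
    differentiations remove.  Explicitly,
    [S_kappa . f] is [f / kappa] ([cq_mul_S_embed]), opposites and sums act on
    the numerator ([cq_opp_frac], [cq_add_frac]), and [D f] is embedded as
    [(kappa * D f) / kappa].

    What remains is that the functions [t ^ p f1 (t)], [p > -1], form a
    commutative and associative algebra under convolution.  Closure is
    [rconv_power]: scaling the variable gives
    [f * g = t ^ (p + q + 1) phi (t)] with [phi] an integral over [0, 1]
    against a fixed Beta kernel, hence continuous.  Commutativity is a
    reflection and associativity is Fubini together with a translation
    ([rconvC], [rconvA]).  All this is done for real functions and transferred
    to real and imaginary parts. *)

(** * Affine changes of variable in the Lebesgue integral *)

Section affine_change_of_variables.
Context {R : realType}.
Local Notation mu := (@lebesgue_measure R).
Implicit Types (a b : R) (F : R -> \bar R).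

Definition affine a b : measurableTypeR R -> measurableTypeR R :=
  fun x => a * x + b.

Lemma measurable_affine a b : measurable_fun setT (affine a b).
Proof.
by apply: measurable_funD => //; exact: measurable_funM.
Qed.

(** The measure structure of a push-forward depends on a proof that the map is
    measurable, which is why the structure is applied explicitly here. *)
Definition affine_image a b : {measure set (measurableTypeR R) -> \bar R} :=
  measure_function_pushforward__canonical__measure_function_Measure
    mu (measurable_affine a b).

(** Lebesgue measure is determined by its values on half-open intervals; the
    preimage of such an interval is a half-open interval that is [1 / |a|]
    times as long. *)
Lemma lebesgue_measure_affine a b (A : set (measurableTypeR R)) :
  a != 0 -> measurable A ->
  mu A = (`|a|%:E * mu (affine a b @^-1` A))%E.
Proof.
move=> a0 mA.
pose c : {nonneg R} := NngNum (normr_ge0 a).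
rewrite -[RHS]/(mscale c (affine_image a b) A); move: A mA.
apply: lebesgue_measure_unique => _ [[u v]] _ <- /=.
rewrite /mscale/= /affine_image /= /pushforward.
have [a_gt0|a_lt0|/eqP] := ltgtP a 0; last by rewrite (negbTE a0).
- have -> : affine a b @^-1` [set` `]u, v]] =
            [set` `[((v - b) / a), ((u - b) / a)[].
    apply/seteqP; split=> x /=; rewrite /affine !in_itv/=;
      rewrite ler_ndivrMr // ltr_ndivlMr // => /andP[? ?]; apply/andP; lra.
  rewrite !lebesgue_measure_itv/= !lte_fin ltr_nM2r ?invr_lt0//.
  rewrite ltrD2r; case: ltP => _; last by rewrite mule0.
  rewrite -EFinD -EFinM ltr0_norm//; congr (_%:E); field.
  by rewrite lt_eqF.
- have -> : affine a b @^-1` [set` `]u, v]] =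
            [set` `](u - b) / a, (v - b) / a]].
    apply/seteqP; split=> x /=; rewrite /affine !in_itv/=;
      rewrite ltr_pdivrMr // ler_pdivlMr // => /andP[? ?]; apply/andP; lra.
  rewrite !lebesgue_measure_itv/= !lte_fin ltr_pM2r ?invr_gt0//.
  rewrite ltrD2r; case: ltP => _; last by rewrite mule0.
  rewrite -EFinD -EFinM gtr0_norm//; congr (_%:E); field.
  by rewrite gt_eqF.
Qed.

Lemma ge0_integral_affine a b F : a != 0 ->
  measurable_fun setT F -> (forall x, 0 <= F x)%E ->
  (\int[mu]_x F x = `|a|%:E * \int[mu]_x F (a * x + b)%R)%E.
Proof.
move=> a0 mF F0.
pose c : {nonneg R} := NngNum (normr_ge0 a).
have mh := measurable_affine a b.
transitivity (\int[mscale c (affine_image a b)]_x F x)%E.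
  by apply: eq_measure_integral => A mA _; exact: lebesgue_measure_affine.
rewrite ge0_integral_mscale//=.
by rewrite ge0_integral_pushforward//= preimage_setT.
Qed.

Lemma integrable_affine a b F : a != 0 ->
  mu.-integrable setT F -> mu.-integrable setT (fun x => F (a * x + b)).
Proof.
move=> a0 /integrableP[mF iF]; apply/integrableP; split.
  exact: (measurableT_comp mF (measurable_affine a b)).
move: iF; rewrite (ge0_integral_affine b a0) //; last exact: measurableT_comp.
rewrite -!ge0_fin_numE; last 2 first.
- exact: integral_ge0.
- by apply: mule_ge0; rewrite ?lee_fin ?normr_ge0 //; apply: integral_ge0.
set I := (X in (_ * X)%E); have I0 : (0 <= I)%E by exact: integral_ge0.
rewrite -[X in _ -> is_true (X \is a fin_num)]/I.
by move: I0; case: I => //=; rewrite gt0_muley // lte_fin normr_gt0.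
Qed.

(** The positive and negative parts are scaled by the same positive constant,
    which distributes over their difference even if one of them has an infinite
    integral. *)
Lemma Rintegral_affine a b (f : R -> R) : a != 0 -> measurable_fun setT f ->
  (\int[mu]_x f x = `|a| * \int[mu]_x f (a * x + b))%R.
Proof.
move=> a0 mf; rewrite /Rintegral.
have mF : measurable_fun setT (EFin \o f) by apply/measurable_EFinP.
suff -> : (\int[mu]_x (f x)%:E = `|a|%:E * \int[mu]_x (f (a * x + b)%R)%:E)%E.
  case: (\int[mu]_x _)%E => //= [|];
    by rewrite mulr_infty gtr0_sg ?normr_gt0 // mul1e mulr0.
rewrite [LHS]integralE.
rewrite (ge0_integral_affine b a0 (measurable_funepos mF)) //.
rewrite (ge0_integral_affine b a0 (measurable_funeneg mF)) //.
set P := (X in (_ * X - _)%E); set N := (X in (_ - _ * X)%E).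
transitivity (`|a|%:E * (P - N))%E; last first.
  rewrite [in RHS]integralE.
  congr (_ * (_ - _))%E; apply: eq_integral => x _ /=.
    by rewrite !funeposE.
  by rewrite !funenegE.
have : (0 <= P)%E by exact: integral_ge0.
have : (0 <= N)%E by exact: integral_ge0.
have g0 : 0 < `|a| by rewrite normr_gt0.
case: P => [p| |//]; case: N => [q| |//] _ _ //=.
- by rewrite -[RHS]/(`|a| * (p - q))%:E mulrBr.
- by rewrite mulry gtr0_sg// mul1e /= mulrNy gtr0_sg// mul1e.
- by rewrite mulry gtr0_sg// mul1e.
- by rewrite mulry gtr0_sg// mul1e /= mulrNy gtr0_sg// mul1e.
Qed.

End affine_change_of_variables.

(** * Integrability of power functions near zero *)

Section power_functions.
Context {R : realType}.
Local Notation mu := (@lebesgue_measure R).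

Lemma continuous_powR_gt0 (p x : R) : 0 < x ->
  {for x, continuous (fun y : R => y `^ p)}.
Proof.
move=> x0; apply: differentiable_continuous; apply/derivable1_diffP.
by apply: derivable_powR; rewrite in_itv/= x0.
Qed.

Lemma integral_powR_le (p a e : R) : -1 < p -> 0 < e < a ->
  (\int[mu]_(x in `[e, a]) (x `^ p)%:E <= ((p + 1)^-1 * a `^ (p + 1))%:E)%E.
Proof.
move=> p1 /andP[e0 ea].
have p1_gt0 : 0 < p + 1 by lra.
pose F := fun x : R => (p + 1)^-1 * x `^ (p + 1).
have F' (x : R) : 0 < x -> is_derive x 1 F (x `^ p).
  move=> x0; have -> : x `^ p = (p + 1)^-1 *: ((p + 1) * x `^ (p + 1 - 1)).
    by rewrite addrK -[RHS]/(_ * _) mulKf// gt_eqF.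
  exact: (is_deriveZ (p + 1)^-1 (is_derive1_powR (p + 1) x0)).
have cF (x : R) : 0 < x -> {for x, continuous F}.
  move=> x0; apply: differentiable_continuous; apply/derivable1_diffP.
  by have [] := F' _ x0.
rewrite (@continuous_FTC2 _ _ F)//; last 3 first.
- apply: continuous_in_subspaceT => x; rewrite inE/= in_itv/= => /andP[ex _].
  by apply: continuous_powR_gt0; apply: lt_le_trans ex.
- split.
  + by move=> x; rewrite in_itv/= => /andP[ex _]; have [] := F' x (lt_trans e0 ex).
  + by apply: cvg_at_right_filter; exact: cF.
  + by apply: cvg_at_left_filter; apply: cF; exact: lt_trans ea.
- move=> x; rewrite in_itv/= => /andP[ex _].
  by rewrite derive1E; have [_ ->] := F' x (lt_trans e0 ex).
by rewrite -EFinB lee_fin lerBlDr lerDl mulr_ge0 ?powR_ge0// invr_ge0 ltW.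
Qed.

(** Monotone convergence along the intervals [[1/(n+1), a]], on which the
    primitive [x ^ (p + 1) / (p + 1)] gives a bound independent of [n]. *)
Lemma integrable_powR (p a : R) : -1 < p ->
  mu.-integrable `]0, a] (fun x => (x `^ p)%:E).
Proof.
move=> p1.
have mp D : measurable_fun D (fun x : R => (x `^ p)%:E).
  by apply/measurable_EFinP; apply: measurable_funTS; exact: measurable_powR.
apply/integrableP; split; first exact: mp.
under eq_integral do rewrite /= ger0_norm ?powR_ge0//.
have [a0|a0] := leP a 0.
  by rewrite set_itv_ge ?integral_set0// bnd_simp -leNgt.
apply: le_lt_trans (ltry ((p + 1)^-1 * a `^ (p + 1))).
rewrite itv_open_bnd_bigcup.
set G := fun n => `[0 + n.+1%:R^-1, a]%classic : set (measurableTypeR R).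
have ndG : nondecreasing_seq G.
  move=> m n mn; rewrite subsetEset; apply: subset_itvr.
  by rewrite bnd_simp lerD2l lef_pV2 ?posrE// ler_nat ltnS.
have mG n : measurable (G n) by exact: measurable_itv.
have xp0 n x : G n x -> (0 <= (x `^ p)%:E)%E.
  by move=> _; rewrite lee_fin powR_ge0.
have Gcvg :=
  ge0_nondecreasing_set_cvg_integral ndG mG (fun n => mp (G n)) xp0.
have /cvg_lim <- // := Gcvg mu.
apply: lime_le.
  apply: ereal_nondecreasing_is_cvgn.
  exact: (ge0_nondecreasing_set_nondecreasing_integral mu ndG mG
    (fun n => mp (G n)) xp0).
apply: nearW => n; have [ea|ae] := ltP (n.+1%:R^-1) a.
  by rewrite /G add0r; apply: integral_powR_le; rewrite ?ea ?invr_gt0 ?ltr0n.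
have ba0 : (0 <= (p + 1)^-1 * a `^ (p + 1))%R.
  by rewrite mulr_ge0 ?powR_ge0// invr_ge0; lra.
rewrite /G add0r; move: ae ba0; rewrite le_eqVlt => /predU1P[->|ae] ba0.
  by rewrite set_itv1 integral_set1 lee_fin.
by rewrite set_itv_ge ?integral_set0 ?lee_fin// bnd_simp -ltNge.
Qed.

End power_functions.

(** * Real functions with a power singularity at zero *)

Section real_class.
Context {R : realType}.
Local Notation mu := (@lebesgue_measure R).
Implicit Types (f g h : R -> R) (t : R).

(** The continuous factor is required on the whole line.  This loses nothing,
    since [f1 |t|] extends a function that is continuous on [[0, +oo)], and it
    spares all relative continuity conditions. *)
Definition Rcm1 f : Prop := exists p (f1 : R -> R),
  [/\ -1 < p, continuous f1 & forall t, 0 < t -> f t = t `^ p * f1 t].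

(** Replacing [f] by [causal f] turns a convolution on [(0, t)] into an integral
    over the whole line, to which Fubini and affine substitutions apply. *)
Definition causal f : R -> R := fun t => if 0 < t then f t else 0.

Lemma eq_integrableR (D : set (measurableTypeR R)) f g :
  measurable D -> {in D, f =1 g} ->
  mu.-integrable D (EFin \o f) -> mu.-integrable D (EFin \o g).
Proof.
by move=> mD fg; apply: eq_integrable => // x xD /=; rewrite fg.
Qed.

Lemma integrable_bounded_mul (D : set (measurableTypeR R)) f g :
  measurable D -> measurable_fun D f -> [bounded f x | x in D] ->
  mu.-integrable D (EFin \o g) -> mu.-integrable D (EFin \o (fun x => f x * g x)).
Proof.
move=> mD mf bf gi; have := integrableMr mD mf bf gi.
by apply: eq_integrable => // x xD.
Qed.

Lemma Rcm1_continuous f t : Rcm1 f -> 0 < t -> {for t, continuous f}.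
Proof.
move=> [p [f1 [_ cf1 fE]]] t0; rewrite /prop_for /continuous_at fE//.
have H : (fun x : R => x `^ p * f1 x) x @[x --> t] --> t `^ p * f1 t.
  by apply: cvgM; [exact: continuous_powR_gt0|exact: cf1].
apply: cvg_trans H; apply: near_eq_cvg.
by near=> x; rewrite fE//; near: x; exact: lt_nbhsr.
Unshelve. all: by end_near. Qed.

Lemma causal_patch f : causal f = f \_ `]0, +oo[.
Proof.
apply/funext => t; rewrite patchE /causal.
case: ifPn => t0; first by rewrite mem_set//= in_itv/= t0.
by rewrite memNset//= in_itv/= andbT; exact/negP.
Qed.

Lemma measurable_causal f : Rcm1 f -> measurable_fun setT (causal f).
Proof.
move=> fR; rewrite causal_patch.
have m0 : measurable (`]0, +oo[%classic : set R) by exact: measurable_itv.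
apply: (measurable_restrictT f m0).1.
apply: open_continuous_measurable_fun => // t.
by rewrite inE/= in_itv/= andbT => /(Rcm1_continuous fR).
Qed.

Lemma bounded_itv f (D : set R) (a b : R) :
  {within `[a, b], continuous f} -> D `<=` `[a, b] -> [bounded f x | x in D].
Proof.
move=> cf Dab.
have [M [Mr MP]] : [bounded f x | x in `[a, b] : set R].
  have := compact_bounded (continuous_compact cf (@segment_compact _ a b)).
  move=> [M [Mr MP]]; exists M; split => // x Mx y yab.
  by apply: MP => //; exists y.
by exists M; split => // x Mx y /Dab; exact: MP.
Qed.

Lemma integrable_Rcm1 f a : Rcm1 f -> mu.-integrable `]0, a] (EFin \o f).
Proof.
move=> [p [f1 [p1 cf1 fE]]].
apply: (@eq_integrableR _ (fun x => f1 x * x `^ p)) => //.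
  by move=> x; rewrite inE/= in_itv/= => /andP[x0 _]; rewrite fE// mulrC.
apply: integrable_bounded_mul => //; last exact: integrable_powR.
- by apply: measurable_funTS; exact: continuous_measurable_fun.
- apply: (@bounded_itv _ _ 0 a); last exact: subset_itv_oc_cc.
  exact: continuous_subspaceT.
Qed.

(** On the first half of [(0, t)] the factor [f (t - x)] is continuous up to the
    boundary, hence bounded, and [g] is integrable; the reflection [x -> t - x]
    exchanges the two halves and the roles of [f] and [g]. *)
Lemma integrable_kernel f g t : Rcm1 f -> Rcm1 g ->
  mu.-integrable setT (EFin \o (fun x => causal f (t - x) * causal g x)).
Proof.
move=> fR gR.
have mK f' g' : Rcm1 f' -> Rcm1 g' ->
    measurable_fun setT (fun x : R => causal f' (t - x) * causal g' x).
  move=> f'R g'R; apply: measurable_funM; last exact: measurable_causal.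
  apply: (measurableT_comp (measurable_causal f'R)).
  exact: measurable_funB.
have [t0|t0] := leP t 0.
  apply: (@eq_integrableR _ (cst 0)) => //; last exact: integrable0.
  move=> x _ /=; rewrite /causal; do 2 case: ifPn; rewrite ?mul0r ?mulr0//.
  lra.
pose half f' g' := (fun x => causal f' (t - x) * causal g' x) \_ `]0, t / 2].
have ihalf f' g' : Rcm1 f' -> Rcm1 g' -> mu.-integrable setT (EFin \o half f' g').
  move=> f'R g'R; rewrite /half -restrict_EFin; apply/integrable_restrict => //.
  rewrite setTI.
  apply: (@eq_integrableR _ (fun x => causal f' (t - x) * g' x)) => //.
    move=> x; rewrite inE/= in_itv/= => /andP[x0 _].
    by rewrite {3}/causal x0.
  apply: integrable_bounded_mul => //; last exact: integrable_Rcm1.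
    apply: measurable_funTS; apply: (measurableT_comp (measurable_causal f'R)).
    exact: measurable_funB.
  apply: (@bounded_itv _ _ 0 (t / 2)); last exact: subset_itv_oc_cc.
  apply: continuous_in_subspaceT => x; rewrite inE/= in_itv/= => /andP[x0 xt].
  have tx : 0 < t - x by lra.
  apply: (@continuous_comp _ _ _ (fun x => t - x) (causal f')).
    by apply: cvgB => //; exact: cvg_cst.
  have := Rcm1_continuous f'R tx; rewrite /prop_for /continuous_at.
  rewrite /causal tx; apply: cvg_trans; apply: near_eq_cvg.
  by near=> y; rewrite ifT//; near: y; exact: lt_nbhsr.
have i1 := ihalf _ _ fR gR.
have n10 : -1 != 0 :> R by rewrite oppr_eq0 oner_neq0.
have i2 := integrable_affine t n10 (ihalf _ _ gR fR).
have i3 := integrableD measurableT (integrable_abse i1) (integrable_abse i2).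
apply: le_integrable i3 => //.
  by apply/measurable_EFinP; exact: (mK f g fR gR).
(* The kernel is dominated by the sum of its first half and of the reflected
   first half of the exchanged kernel; both are extended by zero. *)
move=> x _ /=; rewrite lee_fin [leRHS]ger0_norm ?addr_ge0//.
rewrite /half !patchE; have [x0|x0] := ltP 0 x; last first.
  by rewrite {2}/causal ltNge x0 /= mulr0 normr0 addr_ge0.
have [xt|tx] := ltP x t; last first.
  by rewrite {1}/causal subr_gt0 ltNge tx /= mul0r normr0 addr_ge0.
have [xh|hx] := leP x (t / 2).
  by rewrite [X in `|X| + _]ifT ?lerDl// inE/= in_itv/= x0.
rewrite [X in _ + `|X|]ifT ?inE/= ?in_itv/=; last lra.
rewrite (_ : t - (-1 * x + t) = x); last by ring.
rewrite (_ : -1 * x + t = t - x); last by ring.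
by rewrite [causal g x * _]mulrC lerDr.
Unshelve. all: by end_near. Qed.

End real_class.

(** * Convolution of real functions *)

Section real_convolution.
Context {R : realType}.
Local Notation mu := (@lebesgue_measure R).
Implicit Types (f g h : R -> R) (t : R).

Definition rconv f g t : R := \int[mu]_(x in `]0, t[) (f (t - x) * g x).

Lemma rconvE f g t :
  rconv f g t = \int[mu]_x (causal f (t - x) * causal g x).
Proof.
rewrite /rconv Rintegral_mkcond; apply: eq_Rintegral => x _.
rewrite patchE /causal subr_gt0; case: ifPn => [|/negP xt].
  by rewrite inE/= in_itv/= => /andP[-> ->].
case: ifPn => [x1|]; last by rewrite mul0r.
case: ifPn => [x2|]; last by rewrite mulr0.
by exfalso; apply: xt; rewrite inE/= in_itv/= x1 x2.
Qed.

Lemma rconv_le0 f g t : t <= 0 -> rconv f g t = 0.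
Proof.
by move=> t0; rewrite /rconv set_itv_ge ?Rintegral_set0// bnd_simp -leNgt.
Qed.

(** A convolution is an integral over an empty interval when [t <= 0], so it is
    already extended by zero. *)
Lemma causal_rconv f g : causal (rconv f g) = rconv f g.
Proof.
by apply/funext => t; rewrite /causal; case: ltP => // /rconv_le0 ->.
Qed.

Lemma eq_rconv f f' g g' : (forall t, 0 < t -> f t = f' t) ->
  (forall t, 0 < t -> g t = g' t) -> rconv f g = rconv f' g'.
Proof.
move=> ff gg; apply/funext => t; apply: eq_Rintegral => x.
by rewrite inE/= in_itv/= => /andP[x0 xt]; rewrite ff ?subr_gt0// gg.
Qed.

Lemma rconvC f g : Rcm1 f -> Rcm1 g -> rconv f g = rconv g f.
Proof.
move=> fR gR; apply/funext => t; rewrite !rconvE.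
have /integrableP[/measurable_EFinP mK _] := integrable_kernel t fR gR.
have n10 : -1 != 0 :> R by rewrite oppr_eq0 oner_neq0.
rewrite (Rintegral_affine t n10 mK) normrN1 mul1r.
apply: eq_Rintegral => x _; rewrite mulrC.
by congr (causal _ _ * causal _ _); ring.
Qed.

Lemma causalD f g : causal (fun t => f t + g t) = (fun t => causal f t + causal g t).
Proof. by apply/funext => t; rewrite /causal; case: ifP; rewrite ?addr0. Qed.

Lemma rconvDr f g h : Rcm1 f -> Rcm1 g -> Rcm1 h ->
  rconv f (fun t => g t + h t) = (fun t => rconv f g t + rconv f h t).
Proof.
move=> fR gR hR; apply/funext => t; rewrite !rconvE -RintegralD//; last 2 first.
- exact: integrable_kernel.
- exact: integrable_kernel.
by apply: eq_Rintegral => x _; rewrite causalD mulrDr.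
Qed.

Lemma rconvZr f g (c : R) : Rcm1 f -> Rcm1 g ->
  rconv f (fun t => c * g t) = (fun t => c * rconv f g t).
Proof.
move=> fR gR; apply/funext => t; rewrite !rconvE -RintegralZl//; last first.
  exact: integrable_kernel.
by apply: eq_Rintegral => x _; rewrite /causal; case: ifP => _; case: ifP => _; ring.
Qed.

Lemma Rcm1_powR (p : R) : -1 < p -> Rcm1 (fun t : R => t `^ p).
Proof.
move=> p1; exists p, (cst 1); split => // [|t _]; last by rewrite mulr1.
exact: cst_continuous.
Qed.

(** The substitution [x = t y] moves the dependence on [t] out of the domain and
    out of the singular factors: the integral becomes [t ^ (p + q + 1)] times
    the integral of [f1 (t (1 - y)) g1 (t y)] against the fixed integrable
    kernel [(1 - y) ^ p y ^ q], and dominated convergence makes the latter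
    continuous, including at [t = 0]. *)
Lemma rconv_power (p q : R) (f1 g1 : R -> R) : -1 < p -> -1 < q ->
  continuous f1 -> continuous g1 ->
  exists2 phi : R -> R, continuous phi & forall t, 0 < t ->
    rconv (fun x => x `^ p * f1 x) (fun x => x `^ q * g1 x) t =
    t `^ (p + q + 1) * phi t.
Proof.
move=> p1 q1 cf cg.
pose b := fun x : R => causal (fun x => x `^ p) (1 - x) * causal (fun x => x `^ q) x.
have ib : mu.-integrable setT (EFin \o b).
  by apply: integrable_kernel; exact: Rcm1_powR.
have b0 x : 0 <= b x.
  rewrite /b /causal; case: ifP => _; case: ifP => _;
    by rewrite ?mul0r ?mulr0// mulr_ge0 ?powR_ge0.
pose a := fun t x : R => f1 (t * (1 - x)) * g1 (t * x).
have mulc (c : R) : continuous (fun s : R => s * c).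
  by move=> s; apply: cvgM; [exact: cvg_id|exact: cvg_cst].
have cmul (c : R) : continuous (fun s : R => c * s).
  by move=> s; apply: cvgM; [exact: cvg_cst|exact: cvg_id].
have cmulB (c : R) : continuous (fun s : R => c * (1 - s)).
  move=> s; apply: cvgM; first exact: cvg_cst.
  by apply: cvgB; [exact: cvg_cst|exact: cvg_id].
have compc (u v : R -> R) : continuous u -> continuous v ->
    continuous (fun s => v (u s)).
  by move=> cu cv s; apply: (@continuous_comp _ _ _ u v); [exact: cu|exact: cv].
have ca (x : R) : continuous (a ^~ x).
  move=> t; apply: (@continuousM _ _ (fun t => f1 (t * (1 - x))) (fun t => g1 (t * x))).
    exact: (compc _ _ (mulc (1 - x)) cf).
  exact: (compc _ _ (mulc x) cg).
have ca2 (t : R) : continuous (a t).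
  have c1 := compc _ _ (cmulB t) cf; have c2 := compc _ _ (cmul t) cg.
  by move=> x; have := continuousM (c1 x) (c2 x).
have bounded_cont (u : R -> R) (M : R) : continuous u ->
    exists2 C : R, 0 <= C & forall y : R, `|y| <= M -> `|u y| <= C.
  move=> cu.
  have cu' : {within `[- M, M], continuous u} by exact: continuous_subspaceT.
  have [C [Cr CP]] := bounded_itv cu' (@subset_refl _ _).
  exists (`|C| + 1); first by rewrite addr_ge0.
  move=> y yM; apply: (CP (`|C| + 1)).
    by rewrite (le_lt_trans (ler_norm C))// ltrDl.
  by rewrite /= in_itv/= -ler_norml.
have abound (M : R) : exists2 C : R, 0 <= C & forall t x : R,
    `|t| <= M -> 0 < x < 1 -> `|a t x| <= C.
  have [C1 C10 H1] := bounded_cont f1 M cf.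
  have [C2 C20 H2] := bounded_cont g1 M cg.
  exists (C1 * C2); first exact: mulr_ge0.
  move=> t x tM /andP[x0 x1]; rewrite /a normrM ler_pM//.
    apply: H1; rewrite normrM (le_trans _ tM)// ler_piMr//.
    by rewrite ger0_norm; lra.
  apply: H2; rewrite normrM (le_trans _ tM)// ler_piMr//.
  by rewrite ger0_norm; lra.
pose D := (`]0, 1[%classic : set (measurableTypeR R)).
have mD : measurable D by exact: measurable_itv.
have iab t : mu.-integrable D (EFin \o (fun x => a t x * b x)).
  apply: integrable_bounded_mul => //.
  - by apply: measurable_funTS; apply: continuous_measurable_fun; exact: ca2.
  - have [C C0 CP] := abound `|t|.
    exists C; split; first exact: num_real.
    move=> y Cy x; rewrite /D/= in_itv/= => x01.
    by apply: le_trans (ltW Cy); apply: CP.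
  - exact: integrableS ib.
pose phi t : R := \int[mu]_(x in D) (a t x * b x).
have phic : continuous phi.
  move=> t; have [C C0 CP] := abound (`|t| + 1).
  have tI : t \in `]t - 1, t + 1[%classic by rewrite inE/= in_itv/=; lra.
  apply: (@continuity_under_integral _ _ _ mu (fun t x => a t x * b x) D mD
    (t - 1) (t + 1) _ _ (fun x => C * b x)) => //.
  - apply: aeW => x Dx u _; apply: cvgM; last exact: cvg_cst.
    exact: ca.
  - have := integrableS measurableT mD (@subsetT _ _) ib.
    by move=> /(integrableZl mD C).
  - move=> u; rewrite /= in_itv/= => ut; apply: aeW => x.
    rewrite /D/= in_itv/= => x01; rewrite normrM (ger0_norm (b0 x)).
    apply: ler_wpM2r => //; apply: CP => //.
    rewrite -lerBlDl; apply: le_trans (lerB_dist _ _) _.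
    by rewrite ler_norml; lra.
exists phi => // t t0.
rewrite rconvE.
have Rf : Rcm1 (fun x => x `^ p * f1 x) by exists p, f1.
have Rg : Rcm1 (fun x => x `^ q * g1 x) by exists q, g1.
have /integrableP[/measurable_EFinP mK _] := integrable_kernel t Rf Rg.
have tn0 : t != 0 by rewrite gt_eqF.
rewrite (Rintegral_affine 0 tn0 mK) (gtr0_norm t0).
rewrite /phi -!RintegralZl//; last first.
  exact: (integrable_affine 0 tn0 (integrable_kernel t Rf Rg)).
rewrite [RHS]Rintegral_mkcond; apply: eq_Rintegral => x _.
rewrite (_ : t - (t * x + 0) = t * (1 - x)); last by ring.
rewrite addr0 patchE /causal !pmulr_rgt0// subr_gt0.
have -> : (x \in D) = (0 < x < 1).
  by apply/idP/idP => [/set_mem|xD]; [|apply/mem_set]; rewrite /D/= in_itv.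
case: ifPn => [x1|_]; last by rewrite andbF mul0r mulr0.
case: ifPn => [x0|_]; last by rewrite !mulr0.
rewrite /= /a /b /causal subr_gt0 x0 x1 !powRM ?ltW ?subr_gt0//.
by rewrite !powRD ?(gt_eqF t0) ?implybT// powRr1 ?ltW//; ring.
Qed.

Lemma Rcm1_rconv f g : Rcm1 f -> Rcm1 g -> Rcm1 (rconv f g).
Proof.
move=> [p [f1 [p1 cf fE]]] [q [g1 [q1 cg gE]]].
have [phi cphi phiE] := rconv_power p1 q1 cf cg.
exists (p + q + 1), phi; split => //; first lra.
by move=> t t0; rewrite (eq_rconv fE gE) phiE.
Qed.

Lemma Rcm1_norm f : Rcm1 f -> Rcm1 (fun t => `|f t|).
Proof.
move=> [p [f1 [p1 cf fE]]]; exists p, (fun t => `|f1 t|); split => //.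
  by move=> t; apply: cvg_norm; exact: cf.
by move=> t t0; rewrite fE// normrM ger0_norm ?powR_ge0.
Qed.

Lemma causal_norm f : causal (fun t => `|f t|) = (fun t => `|causal f t|).
Proof. by apply/funext => t; rewrite /causal; case: ifP; rewrite ?normr0. Qed.

Lemma EFin_rconv f g t : Rcm1 f -> Rcm1 g ->
  (\int[mu]_x (causal f (t - x) * causal g x)%:E)%E = (rconv f g t)%:E.
Proof.
move=> fR gR; rewrite rconvE /Rintegral fineK//.
exact: (integrable_fin_num measurableT (integrable_kernel t fR gR)).
Qed.

(** Both sides are iterated integrals of
    [f (t - x) g (x - y) h y] over the plane, the left one after the translation
    [x -> x + y].  Absolute integrability follows from the closure property
    applied to [|g|] and [|h|], and then to [|f|] and [|g| * |h|]. *)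
Lemma rconvA f g h : Rcm1 f -> Rcm1 g -> Rcm1 h ->
  rconv (rconv f g) h = rconv f (rconv g h).
Proof.
move=> fR gR hR; apply/funext => t.
pose F (z : R * R) : \bar R :=
  (causal f (t - z.1) * (causal g (z.1 - z.2) * causal h z.2))%:E.
have mc := measurable_causal.
have mF : measurable_fun setT F.
  apply/measurable_EFinP; apply: measurable_funM.
    apply: (measurableT_comp (mc _ _ fR)); exact: measurable_funB.
  apply: measurable_funM.
    apply: (measurableT_comp (mc _ _ gR)); exact: measurable_funB.
  by apply: (measurableT_comp (mc _ _ hR)).
have fubini_F : (\int[mu]_x \int[mu]_y F (x, y) = \int[mu]_y \int[mu]_x F (x, y))%E.
  apply: Fubini; apply/(integrable12ltyP mu mu mF).
  have gh' := Rcm1_rconv (Rcm1_norm gR) (Rcm1_norm hR).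
  have /integrableP[_] := integrable_kernel t fR gh'.
  apply: le_lt_trans; rewrite le_eqVlt; apply/orP; left; apply/eqP.
  apply: eq_integral => x _.
  have gh0 : 0 <= rconv (fun t => `|g t|) (fun t => `|h t|) x.
    by apply: Rintegral_ge0 => y _; exact: mulr_ge0.
  rewrite /F /= normrM EFinM causal_rconv (ger0_norm gh0).
  rewrite -EFin_rconv; [|exact: Rcm1_norm..].
  rewrite -integralZl//; last exact: integrable_kernel (Rcm1_norm gR) (Rcm1_norm hR).
  by apply: eq_integral => y _; rewrite -EFinM !normrM !causal_norm.
have fgR := Rcm1_rconv fR gR; have ghR := Rcm1_rconv gR hR.
apply: EFin_inj; rewrite -!EFin_rconv//.
transitivity (\int[mu]_y \int[mu]_x F (x, y))%E; last first.
  rewrite -fubini_F; apply: eq_integral => x _.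
  rewrite causal_rconv EFinM -EFin_rconv// -integralZl//.
  exact: integrable_kernel.
apply: eq_integral => y _.
pose K x := causal f (t - x) * causal g (x - y).
have Ky x : K (1 * x + y) = causal f (t - y - x) * causal g x.
  by congr (causal _ _ * causal _ _); ring.
have iK : mu.-integrable setT (EFin \o K).
  have := integrable_affine (- y) (oner_neq0 R) (integrable_kernel (t - y) fR gR).
  apply: eq_integrableR => // x _.
  by congr (causal _ _ * causal _ _); ring.
have /integrableP[/measurable_EFinP mK _] := iK.
transitivity (\int[mu]_x ((K x)%:E * (causal h y)%:E))%E; last first.
  by apply: eq_integral => x _; rewrite -EFinM /F /K /= mulrA.
rewrite integralZr// -(fineK (integrable_fin_num measurableT iK)) -EFinM.
congr (_ * _)%:E; rewrite -[RHS]/(\int[mu]_x K x).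
rewrite (Rintegral_affine y (oner_neq0 R) mK) normr1 mul1r causal_rconv rconvE.
by apply: eq_Rintegral => x _; rewrite Ky.
Qed.

End real_convolution.

(** * Linear structure and the fundamental theorem of calculus *)

Section real_calculus.
Context {R : realType}.
Implicit Types (f g h : R -> R) (t : R).

Lemma continuous_norm_powR (a : R) : 0 <= a ->
  continuous (fun x : R => `|x| `^ a).
Proof.
rewrite le_eqVlt => /predU1P[<-|a0] x.
  by under eq_fun do rewrite powRr0; exact: cst_continuous.
have [->|x0] := eqVneq x 0; last first.
  apply: (@continuous_comp _ _ _ (fun x : R => `|x|) (fun x => x `^ a)).
    exact: norm_continuous.
  by apply: continuous_powR_gt0; rewrite normr_gt0.
rewrite /continuous_at normr0 powR0 ?gt_eqF//.
apply/cvgrPdist_lt => e e0; near=> y.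
rewrite sub0r normrN ger0_norm ?powR_ge0//.
have -> : e = (e `^ a^-1) `^ a by rewrite -powRrM mulVf ?gt_eqF// powRr1 ?ltW.
rewrite gt0_ltr_powR ?nnegrE ?powR_ge0//.
near: y; apply/nbhs_ballP; exists (e `^ a^-1); first exact: powR_gt0.
by move=> y; rewrite /ball/= sub0r normrN.
Unshelve. all: by end_near. Qed.

(** The exponent can be lowered, which brings two functions to a common
    exponent. *)
Lemma Rcm1_weaken (p r : R) f (f1 : R -> R) : r <= p -> continuous f1 ->
  (forall t, 0 < t -> f t = t `^ p * f1 t) ->
  exists2 f2 : R -> R, continuous f2 & forall t, 0 < t -> f t = t `^ r * f2 t.
Proof.
move=> rp cf fE; exists (fun x => `|x| `^ (p - r) * f1 x).
  move=> x; apply: cvgM; last exact: cf.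
  by apply: continuous_norm_powR; rewrite subr_ge0.
move=> t t0; rewrite fE// mulrA (gtr0_norm t0) -powRD ?(gt_eqF t0) ?implybT//.
by rewrite addrC subrK.
Qed.

Lemma Rcm1D f g : Rcm1 f -> Rcm1 g -> Rcm1 (fun t => f t + g t).
Proof.
move=> [p [f1 [p1 cf fE]]] [q [g1 [q1 cg gE]]].
have rp : Num.min p q <= p by rewrite ge_min lexx.
have rq : Num.min p q <= q by rewrite ge_min lexx orbT.
have [f2 cf2 f2E] := Rcm1_weaken rp cf fE.
have [g2 cg2 g2E] := Rcm1_weaken rq cg gE.
exists (Num.min p q), (fun x => f2 x + g2 x); split.
- by rewrite lt_min p1 q1.
- by move=> x; apply: cvgD; [exact: cf2|exact: cg2].
- by move=> t t0; rewrite f2E// g2E// mulrDr.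
Qed.

Lemma Rcm1Z (c : R) f : Rcm1 f -> Rcm1 (fun t => c * f t).
Proof.
move=> [p [f1 [p1 cf fE]]]; exists p, (fun x => c * f1 x); split => //.
  by move=> x; apply: cvgM; [exact: cvg_cst|exact: cf].
by move=> t t0; rewrite fE// mulrCA.
Qed.

Lemma Rcm1_cst (c : R) : Rcm1 (cst c).
Proof.
exists 0, (cst c); split; [lra|exact: cst_continuous|].
by move=> t _; rewrite powRr0 mul1r.
Qed.

Lemma eq_Rcm1 f g : (forall t, 0 < t -> f t = g t) -> Rcm1 f -> Rcm1 g.
Proof.
by move=> fg [p [f1 [p1 cf fE]]]; exists p, f1; split => // t t0; rewrite -fg// fE.
Qed.

Lemma Rcm1B (u v : R -> R) : Rcm1 u -> Rcm1 v -> Rcm1 (fun t => u t - v t).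
Proof.
move=> uR vR; apply: eq_Rcm1 (Rcm1D uR (Rcm1Z (-1) vR)) => t _.
by rewrite mulN1r.
Qed.

Lemma rconvBr (u v w : R -> R) : Rcm1 u -> Rcm1 v -> Rcm1 w ->
  rconv u (fun t => v t - w t) = (fun t => rconv u v t - rconv u w t).
Proof.
move=> uR vR wR; have wN := Rcm1Z (-1) wR.
transitivity (rconv u (fun t => v t + -1 * w t)).
  by apply: eq_rconv => // t _; rewrite mulN1r.
rewrite rconvDr// rconvZr//.
by apply/funext => t; rewrite mulN1r.
Qed.

Lemma rconvDl (u v w : R -> R) : Rcm1 u -> Rcm1 v -> Rcm1 w ->
  rconv (fun t => v t + w t) u = (fun t => rconv v u t + rconv w u t).
Proof.
move=> uR vR wR; have vwR := Rcm1D vR wR.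
by rewrite rconvC// rconvDr// (rconvC uR vR) (rconvC uR wR).
Qed.

Lemma rconvBl (u v w : R -> R) : Rcm1 u -> Rcm1 v -> Rcm1 w ->
  rconv (fun t => v t - w t) u = (fun t => rconv v u t - rconv w u t).
Proof.
move=> uR vR wR; have vwR := Rcm1B vR wR.
by rewrite rconvC// rconvBr// (rconvC uR vR) (rconvC uR wR).
Qed.

Lemma eq_is_derive_gt0 f g t (d : R) : 0 < t -> (forall x : R, 0 < x -> f x = g x) ->
  is_derive t 1 f d -> is_derive t 1 g d.
Proof.
move=> t0 fg; apply: near_eq_is_derive.
by near=> x; rewrite fg//; near: x; exact: lt_nbhsr.
Unshelve. all: by end_near. Qed.

Lemma is_derive_rconv1 f t : Rcm1 f -> 0 < t ->
  is_derive t (1 : R) (rconv (cst 1) f) (f t).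
Proof.
move=> fR t0.
have tt1 : t < t + 1 by rewrite ltrDl.
have [dF F'] := @continuous_FTC1 _ f (BRight 0) t (t + 1) tt1
  (integrable_Rcm1 _ fR) t0 (Rcm1_continuous fR t0).
apply: (@eq_is_derive_gt0 _ _ _ _ t0 _ (DeriveDef dF _)).
  move=> x x0; rewrite /rconv -Rintegral_itv_bndo_bndc; last first.
    by apply: integrableS (integrable_Rcm1 x fR) => //; exact: subset_itv_oo_oc.
  by apply: eq_Rintegral => y _; rewrite mul1r.
by rewrite -derive1E.
Qed.

(** By [rconv_power], the integral from [0] to [x] of [t ^ q g1 (t)] is
    [O (x ^ (q + 1))], and [q + 1 > 0]. *)
Lemma cvg_rconv1 f : Rcm1 f -> rconv (cst 1) f x @[x --> 0^'+] --> 0.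
Proof.
move=> [q [g1 [q1 cg gE]]].
have c1 : continuous (fun _ : R => 1 : R) by move=> x; exact: cvg_cst.
have [phi cphi phiE] := rconv_power (ltrN10 R) q1 c1 cg.
have H : x `^ (0 + q + 1) * phi x @[x --> (0:R)^'+] --> 0 * phi 0.
  apply: cvgM; last by apply: cvg_at_right_filter; exact: cphi.
  by apply: powR_cvg0; lra.
rewrite mul0r in H; apply: cvg_trans H; apply: near_eq_cvg; near=> x.
have x0 : 0 < x by near: x; exact: nbhs_right_gt.
rewrite -phiE// (@eq_rconv _ _ (cst 1) _ f) => // y y0; last by rewrite gE.
by rewrite powRr0 mul1r.
Unshelve. all: by end_near. Qed.

(** [G] differs by a constant from the integral of [g] from zero, which vanishes
    at zero; so the existence of the limit of [G] is part of the conclusion. *)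
Lemma Rcm1_primitive (G g : R -> R) : Rcm1 g ->
  (forall t, 0 < t -> is_derive t (1 : R) G (g t)) ->
  exists2 c : R, G x @[x --> 0^'+] --> c &
    forall t, 0 < t -> G t = c + rconv (cst 1) g t.
Proof.
move=> gR G'.
pose H t := G t - rconv (cst 1) g t.
have H' t : 0 < t -> is_derive t (1 : R) H 0.
  move=> t0; have d1 := G' _ t0; have d2 := is_derive_rconv1 gR t0.
  by rewrite -(subrr (g t)); apply: is_deriveB.
have HE t : 0 < t -> H t = H 1.
  have cst_on a b : 0 < a -> a <= b -> H a = H b.
    move=> a0 ab.
    have dH (x : R) : x \in `]a, b[ -> is_derive x (1 : R) H (cst 0 x).
      by rewrite in_itv/= => /andP[ax _]; apply: H'; exact: lt_trans ax.
    have cH : {within `[a, b], continuous H}.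
      apply: continuous_in_subspaceT => x; rewrite inE/= in_itv/= => /andP[ax _].
      apply: differentiable_continuous; apply/derivable1_diffP.
      by have [] := H' x (lt_le_trans a0 ax).
    have [c _] := MVT_segment ab dH cH.
    by rewrite mul0r => /eqP; rewrite subr_eq0 => /eqP.
  move=> t0; have /orP[t1|t1] := le_total t 1; first exact: cst_on.
  by rewrite (cst_on 1 t).
exists (H 1).
  have H2 : H 1 + rconv (cst 1) g x @[x --> 0^'+] --> H 1 + 0.
    by apply: cvgD; [exact: cvg_cst|exact: cvg_rconv1].
  rewrite addr0 in H2; apply: cvg_trans H2; apply: near_eq_cvg; near=> x.
  have x0 : 0 < x by near: x; exact: nbhs_right_gt.
  by rewrite -(HE x x0) /H subrK.
by move=> t t0; rewrite -(HE t t0) /H subrK.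
Unshelve. all: by end_near. Qed.

End real_calculus.

(** * The convolution ring of complex-valued functions *)

Local Open Scope complex_scope.

Section complex_convolution.
Context {R : realType}.
Local Notation mu := (@lebesgue_measure R).
Implicit Types (f g h : R -> R[i]) (t : R).

Definition Ccm1 f : Prop := Rcm1 (Re_fun f) /\ Rcm1 (Im_fun f).

Lemma eq_complexP (x y : R[i]) : complex.Re x = complex.Re y ->
  complex.Im x = complex.Im y -> x = y.
Proof. by case: x => a b; case: y => c d /= -> ->. Qed.

Lemma complex_ReM (x y : R[i]) : complex.Re (x * y) =
  complex.Re x * complex.Re y - complex.Im x * complex.Im y.
Proof. by case: x => a b; case: y. Qed.

Lemma complex_ImM (x y : R[i]) : complex.Im (x * y) =
  complex.Re x * complex.Im y + complex.Im x * complex.Re y.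
Proof. by case: x => a b; case: y. Qed.

Lemma complex_ReD (x y : R[i]) : complex.Re (x + y) = complex.Re x + complex.Re y.
Proof. by case: x => a b; case: y. Qed.

Lemma complex_ImD (x y : R[i]) : complex.Im (x + y) = complex.Im x + complex.Im y.
Proof. by case: x => a b; case: y. Qed.

Lemma integrable_rconv (u v : R -> R) t : Rcm1 u -> Rcm1 v ->
  mu.-integrable `]0, t[ (EFin \o (fun x => u (t - x) * v x)).
Proof.
move=> uR vR; have mD : measurable (`]0, t[%classic : set (measurableTypeR R)).
  exact: measurable_itv.
have := integrableS measurableT mD (@subsetT _ _) (integrable_kernel t uR vR).
apply: eq_integrableR => // x; rewrite inE/= in_itv/= => /andP[x0 xt].
by rewrite /causal subr_gt0 x0 xt.
Qed.

(** The integral of a complex function is taken componentwise, so splitting it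
    needs the integrability of the four real kernels. *)
Lemma lconvE f g : Ccm1 f -> Ccm1 g -> lconv f g = fun t =>
  (rconv (Re_fun f) (Re_fun g) t - rconv (Im_fun f) (Im_fun g) t) +i*
  (rconv (Re_fun f) (Im_fun g) t + rconv (Im_fun f) (Re_fun g) t).
Proof.
move=> [fr fi] [gr gi]; apply/funext => t; rewrite /lconv /cintegral /rconv.
congr (_ +i* _).
  rewrite -RintegralB//; [|exact: integrable_rconv..].
  by apply: eq_Rintegral => x _; rewrite /Re_fun complex_ReM.
rewrite -RintegralD//; [|exact: integrable_rconv..].
by apply: eq_Rintegral => x _; rewrite /Im_fun complex_ImM.
Qed.

Lemma eq_lconv f f' g g' : (forall t, 0 < t -> f t = f' t) ->
  (forall t, 0 < t -> g t = g' t) -> lconv f g = lconv f' g'.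
Proof.
move=> ff gg; apply/funext => t; rewrite /lconv /cintegral.
by congr (_ +i* _); apply: eq_Rintegral => x; rewrite inE/= in_itv/= => /andP[x0 xt];
  rewrite /Re_fun /Im_fun ff ?subr_gt0// gg.
Qed.

Lemma lconv_le0 f g t : t <= 0 -> lconv f g t = 0.
Proof.
by move=> t0; rewrite /lconv /cintegral set_itv_ge ?Rintegral_set0// bnd_simp -leNgt.
Qed.

Lemma eq_Ccm1 f g : (forall t, 0 < t -> f t = g t) -> Ccm1 f -> Ccm1 g.
Proof.
by move=> fg [fr fi]; split; [move: fr|move: fi]; apply: eq_Rcm1 => t t0;
  rewrite /Re_fun /Im_fun fg.
Qed.

Lemma Ccm1D f g : Ccm1 f -> Ccm1 g -> Ccm1 (fun t => f t + g t).
Proof.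
move=> [fr fi] [gr gi]; split.
  by apply: eq_Rcm1 (Rcm1D fr gr) => t _; rewrite /Re_fun complex_ReD.
by apply: eq_Rcm1 (Rcm1D fi gi) => t _; rewrite /Im_fun complex_ImD.
Qed.

Lemma Ccm1Z (c : R[i]) f : Ccm1 f -> Ccm1 (fun t => c * f t).
Proof.
move=> [fr fi]; split.
  apply: eq_Rcm1 (Rcm1D (Rcm1Z (complex.Re c) fr) (Rcm1Z (- complex.Im c) fi)) => t _.
  by rewrite /Re_fun complex_ReM mulNr.
apply: eq_Rcm1 (Rcm1D (Rcm1Z (complex.Re c) fi) (Rcm1Z (complex.Im c) fr)) => t _.
by rewrite /Im_fun complex_ImM.
Qed.

Lemma Ccm1N f : Ccm1 f -> Ccm1 (fun t => - f t).
Proof. by move=> /(Ccm1Z (-1)); apply: eq_Ccm1 => t _; rewrite mulN1r. Qed.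

Lemma Ccm1B f g : Ccm1 f -> Ccm1 g -> Ccm1 (fun t => f t - g t).
Proof. by move=> fC gC; exact: Ccm1D fC (Ccm1N gC). Qed.

Lemma Ccm1_0 : Ccm1 (fun=> 0).
Proof. by split; exact: Rcm1_cst. Qed.

Lemma Ccm1_sum n (F : 'I_n -> R -> R[i]) : (forall i, Ccm1 (F i)) ->
  Ccm1 (fun t => \sum_(i < n) F i t).
Proof.
elim: n F => [|n IHn] F FC.
  by apply: eq_Ccm1 Ccm1_0 => t _; rewrite big_ord0.
have := Ccm1D (IHn _ (fun i => FC (widen_ord (leqnSn n) i))) (FC ord_max).
by apply: eq_Ccm1 => t _; rewrite big_ord_recr.
Qed.

Lemma Ccm1_lconv f g : Ccm1 f -> Ccm1 g -> Ccm1 (lconv f g).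
Proof.
move=> fC gC; rewrite lconvE//; case: fC gC => [fr fi] [gr gi]; split.
  by apply: eq_Rcm1 (Rcm1B (Rcm1_rconv fr gr) (Rcm1_rconv fi gi)).
by apply: eq_Rcm1 (Rcm1D (Rcm1_rconv fr gi) (Rcm1_rconv fi gr)).
Qed.

Lemma lconvC f g : Ccm1 f -> Ccm1 g -> lconv f g = lconv g f.
Proof.
move=> fC gC; rewrite !lconvE//; case: fC gC => [fr fi] [gr gi].
apply/funext => t; congr (_ +i* _).
  by rewrite (rconvC fr gr) (rconvC fi gi).
by rewrite (rconvC fr gi) (rconvC fi gr) addrC.
Qed.

Lemma lconvA f g h : Ccm1 f -> Ccm1 g -> Ccm1 h ->
  lconv (lconv f g) h = lconv f (lconv g h).
Proof.
move=> fC gC hC; have fgC := Ccm1_lconv fC gC; have ghC := Ccm1_lconv gC hC.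
rewrite (lconvE fgC hC) (lconvE fC ghC) (lconvE fC gC) (lconvE gC hC).
move: fC gC hC => [fr fi] [gr gi] [hr hi].
rewrite /Re_fun /Im_fun /= -/(Re_fun f) -/(Re_fun g) -/(Re_fun h).
rewrite -/(Im_fun f) -/(Im_fun g) -/(Im_fun h).
have [rr rA] := (@Rcm1_rconv R, @rconvA R).
have [frgr figi] := (rr _ _ fr gr, rr _ _ fi gi).
have [frgi figr] := (rr _ _ fr gi, rr _ _ fi gr).
have [grhr gihi] := (rr _ _ gr hr, rr _ _ gi hi).
have [grhi gihr] := (rr _ _ gr hi, rr _ _ gi hr).
apply/funext => t; congr (_ +i* _).
  rewrite (rconvBl hr frgr figi) (rconvDl hi frgi figr).
  rewrite (rconvBr fr grhr gihi) (rconvDr fi grhi gihr).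
  rewrite (rA _ _ _ fr gr hr) (rA _ _ _ fi gi hr) (rA _ _ _ fr gi hi) (rA _ _ _ fi gr hi).
  have E (a b c d : R) : a - b - (c + d) = a - c - (d + b) by ring.
  exact: E.
rewrite (rconvBl hi frgr figi) (rconvDl hr frgi figr).
rewrite (rconvDr fr grhi gihr) (rconvBr fi grhr gihi).
rewrite (rA _ _ _ fr gr hi) (rA _ _ _ fi gi hi) (rA _ _ _ fr gi hr) (rA _ _ _ fi gr hr).
have E (a b c d : R) : a - b + (c + d) = a + c + (d - b) by ring.
exact: E.
Qed.

Lemma lconvDr f g h : Ccm1 f -> Ccm1 g -> Ccm1 h ->
  lconv f (fun t => g t + h t) = (fun t => lconv f g t + lconv f h t).
Proof.
move=> fC gC hC; have ghC := Ccm1D gC hC; rewrite !lconvE//.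
move: fC gC hC => [fr fi] [gr gi] [hr hi].
have -> : Re_fun (fun t => g t + h t) = (fun t => Re_fun g t + Re_fun h t).
  by apply/funext => t; rewrite /Re_fun complex_ReD.
have -> : Im_fun (fun t => g t + h t) = (fun t => Im_fun g t + Im_fun h t).
  by apply/funext => t; rewrite /Im_fun complex_ImD.
have E1 (a b c d : R) : a + b - (c + d) = a - c + (b - d) by ring.
have E2 (a b c d : R) : a + b + (c + d) = a + c + (b + d) by ring.
rewrite !rconvDr//; apply/funext => t.
by apply: eq_complexP; rewrite ?complex_ReD ?complex_ImD /=; [exact: E1|exact: E2].
Qed.

Lemma lconvZr (c : R[i]) f g : Ccm1 f -> Ccm1 g ->
  lconv f (fun t => c * g t) = (fun t => c * lconv f g t).
Proof.
move=> fC gC; have cgC := Ccm1Z c gC; rewrite !lconvE//.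
move: fC gC => [fr fi] [gr gi].
have -> : Re_fun (fun t => c * g t) =
    (fun t => complex.Re c * Re_fun g t - complex.Im c * Im_fun g t).
  by apply/funext => t; rewrite /Re_fun complex_ReM.
have -> : Im_fun (fun t => c * g t) =
    (fun t => complex.Re c * Im_fun g t + complex.Im c * Re_fun g t).
  by apply/funext => t; rewrite /Im_fun complex_ImM.
set x := complex.Re c; set y := complex.Im c.
have [xgr ygr] := (Rcm1Z x gr, Rcm1Z y gr).
have [xgi ygi] := (Rcm1Z x gi, Rcm1Z y gi).
rewrite (rconvBr fr xgr ygi) (rconvBr fi xgr ygi).
rewrite (rconvDr fr xgi ygr) (rconvDr fi xgi ygr) !rconvZr//.
have E1 (a b d e : R) :
  x * a - y * b - (x * d + y * e) = x * (a - d) - y * (b + e) by ring.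
have E2 (a b d e : R) :
  x * b + y * a + (x * e - y * d) = x * (b + e) + y * (a - d) by ring.
apply/funext => t.
by apply: eq_complexP; rewrite ?complex_ReM ?complex_ImM /=; [exact: E1|exact: E2].
Qed.

Lemma lconvNr f g : Ccm1 f -> Ccm1 g ->
  lconv f (fun t => - g t) = (fun t => - lconv f g t).
Proof.
move=> fC gC; transitivity (lconv f (fun t => -1 * g t)).
  by apply: eq_lconv => // t _; rewrite mulN1r.
by rewrite lconvZr//; apply/funext => t; rewrite mulN1r.
Qed.

Lemma lconvBr f g h : Ccm1 f -> Ccm1 g -> Ccm1 h ->
  lconv f (fun t => g t - h t) = (fun t => lconv f g t - lconv f h t).
Proof.
by move=> fC gC hC; rewrite lconvDr ?lconvNr//; exact: Ccm1N.
Qed.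

Lemma lconv_sumr n (c : 'I_n -> R[i]) f (F : 'I_n -> R -> R[i]) :
  Ccm1 f -> (forall i, Ccm1 (F i)) ->
  lconv f (fun t => \sum_(i < n) c i * F i t) =
  (fun t => \sum_(i < n) c i * lconv f (F i) t).
Proof.
move=> fC; elim: n c F => [|n IHn] c F FC.
  transitivity (lconv f (fun t => 0 * f t)).
    by apply: eq_lconv => // t _; rewrite big_ord0 mul0r.
  by rewrite lconvZr//; apply/funext => t; rewrite big_ord0 mul0r.
pose w := widen_ord (leqnSn n).
have SC : Ccm1 (fun t => \sum_(i < n) c (w i) * F (w i) t).
  by apply: Ccm1_sum => i; exact: Ccm1Z.
transitivity (lconv f (fun t => \sum_(i < n) c (w i) * F (w i) t + c ord_max * F ord_max t)).
  by apply: eq_lconv => // t _; rewrite big_ord_recr.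
rewrite lconvDr//; last exact: Ccm1Z.
rewrite lconvZr// IHn//; apply/funext => t.
by rewrite big_ord_recr.
Qed.

Lemma lconvDl f g h : Ccm1 f -> Ccm1 g -> Ccm1 h ->
  lconv (fun t => g t + h t) f = (fun t => lconv g f t + lconv h f t).
Proof.
move=> fC gC hC; have ghC := Ccm1D gC hC.
by rewrite lconvC// lconvDr// (lconvC fC gC) (lconvC fC hC).
Qed.

Lemma lconvNl f g : Ccm1 f -> Ccm1 g ->
  lconv (fun t => - g t) f = (fun t => - lconv g f t).
Proof.
move=> fC gC; have gN := Ccm1N gC.
by rewrite lconvC// lconvNr// (lconvC fC gC).
Qed.

Lemma lconvCA f g h : Ccm1 f -> Ccm1 g -> Ccm1 h ->
  lconv f (lconv g h) = lconv g (lconv f h).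
Proof. by move=> fC gC hC; rewrite -(lconvA fC gC hC) -(lconvA gC fC hC) (lconvC fC gC). Qed.

Lemma lconvAC f g h : Ccm1 f -> Ccm1 g -> Ccm1 h ->
  lconv (lconv f g) h = lconv (lconv f h) g.
Proof. by move=> fC gC hC; rewrite (lconvA fC gC hC) (lconvA fC hC gC) (lconvC gC hC). Qed.

(** Convolutions vanish for [t <= 0], so agreement on [t > 0], which is what
    equivalence of fractions asks for, is plain equality of functions. *)
Lemma lconv_ext f g f' g' : (forall t, 0 < t -> lconv f g t = lconv f' g' t) ->
  lconv f g = lconv f' g'.
Proof.
move=> E; apply/funext => t; have [t0|t0] := ltP 0 t; first exact: E.
by rewrite !lconv_le0.
Qed.

End complex_convolution.

(** * Iterated derivatives and Taylor expansion at zero *)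

Section complex_calculus.
Context {R : realType}.
Local Notation mu := (@lebesgue_measure R).
Implicit Types (f g h : R -> R[i]) (t : R).

Definition cis_derive f t (d : R[i]) : Prop :=
  is_derive t (1 : R) (Re_fun f) (complex.Re d) /\
  is_derive t (1 : R) (Im_fun f) (complex.Im d).

(** The intermediate derivatives are existentially quantified, so that values at
    [t <= 0] never matter and such chains can be composed and added directly. *)
Fixpoint is_nth_deriv n f g : Prop :=
  if n is m.+1 then exists f' : R -> R[i],
    (forall t, 0 < t -> cis_derive f t (f' t)) /\ is_nth_deriv m f' g
  else forall t, 0 < t -> f t = g t.

Lemma eq_cis_derive f g t d : (forall x, 0 < x -> f x = g x) -> 0 < t ->
  cis_derive f t d -> cis_derive g t d.
Proof.
move=> fg t0 [d1 d2]; split; [move: d1|move: d2]; apply: eq_is_derive_gt0 => // x x0.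
  by rewrite /Re_fun fg.
by rewrite /Im_fun fg.
Qed.

Lemma cis_derive_unique f t d d' : cis_derive f t d -> cis_derive f t d' -> d = d'.
Proof.
move=> [[_ a] [_ b]] [[_ a'] [_ b']]; apply: eq_complexP.
  by rewrite -a -a'.
by rewrite -b -b'.
Qed.

Lemma cis_deriveD f g t d e : cis_derive f t d -> cis_derive g t e ->
  cis_derive (fun x => f x + g x) t (d + e).
Proof.
move=> [f1 f2] [g1 g2]; split.
  rewrite complex_ReD (_ : Re_fun _ = Re_fun f + Re_fun g); first exact: is_deriveD.
  by apply/funext => x; rewrite /Re_fun complex_ReD.
rewrite complex_ImD (_ : Im_fun _ = Im_fun f + Im_fun g); first exact: is_deriveD.
by apply/funext => x; rewrite /Im_fun complex_ImD.
Qed.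

Lemma cis_deriveZ (c : R[i]) f t d : cis_derive f t d ->
  cis_derive (fun x => c * f x) t (c * d).
Proof.
move=> [f1 f2]; split.

  rewrite complex_ReM (_ : Re_fun _ = complex.Re c *: Re_fun f - complex.Im c *: Im_fun f).
    by apply: is_deriveB.
  by apply/funext => x; rewrite /Re_fun complex_ReM.
rewrite complex_ImM (_ : Im_fun _ = complex.Re c *: Im_fun f + complex.Im c *: Re_fun f).
  by apply: is_deriveD.
by apply/funext => x; rewrite /Im_fun complex_ImM.
Qed.

Lemma eq_is_nth_deriv n f f' g : (forall t, 0 < t -> f t = f' t) ->
  is_nth_deriv n f g -> is_nth_deriv n f' g.
Proof.
case: n => [|n] ff /=; first by move=> fg t t0; rewrite -ff// fg.
move=> [u [fu ug]]; exists u; split => // t t0.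
by apply: eq_cis_derive (fu t t0).
Qed.

Lemma is_nth_deriv_unique n f f' g g' : (forall t, 0 < t -> f t = f' t) ->
  is_nth_deriv n f g -> is_nth_deriv n f' g' -> forall t, 0 < t -> g t = g' t.
Proof.
elim: n f f' => [|n IHn] f f' ff /=.
  by move=> fg fg' t t0; rewrite -fg// -fg'// ff.
move=> [u [fu ug]] [u' [fu' ug']]; apply: (IHn u u') => // t t0.
by apply: cis_derive_unique (fu' t t0); apply: eq_cis_derive (fu t t0).
Qed.

Lemma is_nth_deriv_comp m n f g h :
  is_nth_deriv m f g -> is_nth_deriv n g h -> is_nth_deriv (m + n) f h.
Proof.
elim: m f => [|m IHm] f /=.
  by move=> fg; apply: eq_is_nth_deriv => t t0; rewrite fg.
by move=> [u [fu ug]] gh; exists u; split => //; exact: IHm.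
Qed.

Lemma is_nth_derivD n f f' g g' : is_nth_deriv n f g -> is_nth_deriv n f' g' ->
  is_nth_deriv n (fun t => f t + f' t) (fun t => g t + g' t).
Proof.
elim: n f f' => [|n IHn] f f' /=; first by move=> fg fg' t t0; rewrite fg// fg'.
move=> [u [fu ug]] [u' [fu' ug']]; exists (fun t => u t + u' t); split.
  by move=> t t0; apply: cis_deriveD; [exact: fu|exact: fu'].
exact: IHn.
Qed.

Lemma is_nth_derivZ n (c : R[i]) f g : is_nth_deriv n f g ->
  is_nth_deriv n (fun t => c * f t) (fun t => c * g t).
Proof.
elim: n f => [|n IHn] f /=; first by move=> fg t t0; rewrite fg.
move=> [u [fu ug]]; exists (fun t => c * u t); split => [t t0|]; last exact: IHn.
by apply: cis_deriveZ; exact: fu.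
Qed.

Lemma is_nth_deriv0 n : is_nth_deriv n (fun=> 0) (fun=> 0).
Proof.
elim: n => [//|n IHn] /=; exists (fun=> 0); split => // t t0.
by split; exact: is_derive_cst.
Qed.

Lemma is_nth_deriv_sum n m (c : 'I_m -> R[i]) (f g : 'I_m -> R -> R[i]) :
  (forall i, is_nth_deriv n (f i) (g i)) ->
  is_nth_deriv n (fun t => \sum_(i < m) c i * f i t)
                 (fun t => \sum_(i < m) c i * g i t).
Proof.
elim: m c f g => [|m IHm] c f g fg.
  have := is_nth_deriv0 n.
  rewrite (_ : (fun t => \sum_(i < 0) c i * f i t) = (fun=> 0)).
    by rewrite (_ : (fun t => \sum_(i < 0) c i * g i t) = (fun=> 0))//;
      apply/funext => t; rewrite big_ord0.
  by apply/funext => t; rewrite big_ord0.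
under eq_fun do rewrite big_ord_recr /=.
under [X in is_nth_deriv _ _ X]eq_fun do rewrite big_ord_recr /=.
apply: is_nth_derivD; last exact: is_nth_derivZ.
exact: (IHm (fun i => c (widen_ord (leqnSn m) i))
  (fun i => f (widen_ord (leqnSn m) i)) (fun i => g (widen_ord (leqnSn m) i))).
Qed.

Lemma cderiven0 f : cderiven 0 f = f.
Proof. by apply/funext => t; exact: eq_complexP. Qed.

Lemma cderivenS n f : cderiven n.+1 f = cderiven n (cderiven 1 f).
Proof. by apply/funext => t; rewrite /cderiven !derive1Sn. Qed.

Lemma cis_derive_cderiven n m f t : cderivablen m f -> (n < m)%N -> 0 < t ->
  cis_derive (cderiven n f) t (cderiven n.+1 f t).
Proof.
move=> df nm t0; have [d1 d2] := df n t nm t0; split.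
  by apply: (DeriveDef d1); rewrite -derive1E.
by apply: (DeriveDef d2); rewrite -derive1E.
Qed.

Lemma is_nth_deriv_cderiven n f : cderivablen n f ->
  is_nth_deriv n f (cderiven n f).
Proof.
elim: n f => [|n IHn] f df; first by rewrite cderiven0.
rewrite /=; exists (cderiven 1 f); split.
  by move=> t t0; have := cis_derive_cderiven df (ltn0Sn n) t0; rewrite cderiven0.
rewrite (cderivenS n); apply: IHn => i t ni t0.
by have := df i.+1 t ni t0; rewrite !derive1Sn.
Qed.

Lemma cderivablenW m n f : (m <= n)%N -> cderivablen n f -> cderivablen m f.
Proof. by move=> mn df i t im; apply: df; exact: leq_trans im mn. Qed.

Local Notation h_ := (@hfun R).

Lemma Ccm1_hfun n : Ccm1 (h_ n).
Proof.
split; last exact: Rcm1_cst.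
exists 0, (fun t => t ^+ n.-1 / (n.-1)`!%:R); split; first lra.
  move=> t; apply: cvgM; last exact: cvg_cst.
  exact: exprn_continuous.
by move=> t _; rewrite powRr0 mul1r.
Qed.

Lemma lconv_hfun1 f : Ccm1 f -> lconv (h_ 1) f = fun t =>
  rconv (cst 1) (Re_fun f) t +i* rconv (cst 1) (Im_fun f) t.
Proof.
move=> fC; rewrite (lconvE (Ccm1_hfun 1) fC); apply/funext => t.
have -> : Re_fun (h_ 1) = cst 1.
  by apply/funext => x; rewrite /Re_fun /hfun /= expr0 fact0 divr1.
have -> : Im_fun (h_ 1) = cst 0 by [].
have r0 (u : R -> R) : rconv (cst 0) u t = 0.
  transitivity (\int[mu]_(x in `]0, t[) (0 : R)).
    by apply: eq_Rintegral => x _; rewrite mul0r.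
  by rewrite Rintegral_cst// mul0r.
by rewrite !r0 subr0 addr0.
Qed.

Lemma cis_derive_lconv1 f t : Ccm1 f -> 0 < t ->
  cis_derive (lconv (h_ 1) f) t (f t).
Proof.
move=> fC t0; rewrite lconv_hfun1//; case: fC => [fr fi].
by split; exact: is_derive_rconv1.
Qed.

Lemma Ccm1_primitive f g : Ccm1 g -> (forall t, 0 < t -> cis_derive f t (g t)) ->
  forall t, 0 < t -> f t = climit0 f + lconv (h_ 1) g t.
Proof.
move=> gC fg t t0; rewrite lconv_hfun1//; case: gC => gr gi.
have [c1 f1 fE1] := Rcm1_primitive gr (fun x xp => (fg x xp).1).
have [c2 f2 fE2] := Rcm1_primitive gi (fun x xp => (fg x xp).2).
have l1 := cvg_lim (@Rhausdorff R) f1.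
have l2 := cvg_lim (@Rhausdorff R) f2.
rewrite /climit0 l1 l2.
by apply: eq_complexP => /=; [rewrite -[LHS]/(Re_fun f t) fE1|rewrite -[LHS]/(Im_fun f t) fE2].
Qed.

(** [h_(n+1)] vanishes at zero and has derivative [h_n], so it is the integral of
    [h_n] from zero. *)
Lemma hfunS n t : (0 < n)%N -> 0 < t ->
  h_ n.+1 t = lconv (h_ 1) (h_ n) t.
Proof.
move=> n0 t0.
have H (x : R) : 0 < x -> cis_derive (h_ n.+1) x (h_ n x).
  move=> _; split; last exact: is_derive_cst.
  case: n n0 => [//|m] _.
  have D := is_deriveZ ((m.+1)`!%:R^-1 : R) (is_deriveX m.+1 (is_derive_id x (1 : R))).
  move: D; set G := (X in is_derive _ _ X _); have -> : G = Re_fun (h_ m.+2).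
    apply/funext => y; rewrite /Re_fun /hfun /G /= exprfctE; exact: mulrC.
  move=> D; apply: (is_derive_eq D).
  rewrite /hfun /= factS natrM.
  rewrite -[LHS]/(_ * (_ * 1)) mulr1 invfM mulrACA mulVf ?pnatr_eq0//.
  by rewrite mul1r mulrC.
rewrite (Ccm1_primitive (Ccm1_hfun n) H t0) -[RHS]add0r; congr (_ + _).
have l1 : Re_fun (h_ n.+1) x @[x --> 0^'+] --> 0.
  have : x ^+ n / n`!%:R @[x --> (0 : R)] --> (0 ^+ n / n`!%:R : R).
    by apply: cvgM; [exact: exprn_continuous|exact: cvg_cst].
  by rewrite expr0n gtn_eqF// mul0r => /cvg_at_right_filter.
have l2 : Im_fun (h_ n.+1) x @[x --> 0^'+] --> 0 by exact: cvg_cst.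
by rewrite /climit0 (cvg_lim (@Rhausdorff R) l1) (cvg_lim (@Rhausdorff R) l2).
Qed.

Lemma lconv_hfunS n f : (0 < n)%N -> Ccm1 f ->
  lconv (h_ n.+1) f = lconv (h_ 1) (lconv (h_ n) f).
Proof.
move=> n0 fC; rewrite -lconvA//; [|exact: Ccm1_hfun..].
by apply: eq_lconv => // t t0; rewrite hfunS.
Qed.

(** [h_n] is the n-fold convolution power of [h_1], and convolution with [h_1] is
    integration from zero. *)
Lemma is_nth_deriv_lconv n f : (0 < n)%N -> Ccm1 f ->
  is_nth_deriv n (lconv (h_ n) f) f.
Proof.
case: n => [//|n] _ fC; elim: n => [|n IHn].
  by exists f; split => // t t0; exact: cis_derive_lconv1.
exists (lconv (h_ n.+1) f); split => // t t0.
rewrite lconv_hfunS//; apply: cis_derive_lconv1 => //.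
by apply: Ccm1_lconv => //; exact: Ccm1_hfun.
Qed.

(** Induction on [n]: the expansion of order [n + 1] has remainder
    [h_(n+1) * f^(n+1)], into which one substitutes
    [f^(n+1) = c + h_1 * f^(n+2)]. *)
Lemma taylor_at0 n f : (0 < n)%N -> cderivablen n f -> Ccm1 (cderiven n f) ->
  forall t, 0 < t -> f t = \sum_(i < n) climit0 (cderiven i f) * h_ i.+1 t +
    lconv (h_ n) (cderiven n f) t.
Proof.
case: n => [//|n] _; elim: n => [|n IHn] df nC t t0.
  rewrite big_ord_recr big_ord0 /= add0r cderiven0.
  have -> : h_ 1 t = 1 by rewrite /hfun expr0 fact0 divr1.
  rewrite mulr1; apply: Ccm1_primitive => // x x0.
  by have := cis_derive_cderiven df (ltn0Sn 0) x0; rewrite cderiven0.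
set c := climit0 (cderiven n.+1 f).
have hC := Ccm1_hfun.
have h1C := Ccm1_lconv (hC 1) nC.
have E x : 0 < x -> cderiven n.+1 f x =
    c * h_ 1 x + lconv (h_ 1) (cderiven n.+2 f) x.
  move=> x0; have -> : h_ 1 x = 1 by rewrite /hfun expr0 fact0 divr1.
  rewrite mulr1 /c.
  exact: (Ccm1_primitive nC (fun y y0 => cis_derive_cderiven df (ltnSn _) y0) x0).
have n1C : Ccm1 (cderiven n.+1 f).
  by apply: eq_Ccm1 (Ccm1D (Ccm1Z c (hC 1)) h1C) => x x0; rewrite E.
rewrite (IHn (cderivablenW (leqnSn _) df) n1C t t0).
rewrite [in RHS]big_ord_recr /= -addrA; congr (_ + _).
rewrite (eq_lconv (f' := h_ n.+1) (fun _ _ => erefl) E).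
rewrite lconvDr//; last exact: Ccm1Z.
rewrite lconvZr// -/c (lconvC (hC n.+1) (hC 1)) -hfunS//; congr (_ + _).
by rewrite -lconvA// (lconvC (hC n.+1) (hC 1)) lconvA// -lconv_hfunS.
Qed.

End complex_calculus.

(** * The function class over either scalar field *)

Section function_class.
Context {R : realType} (K : scalars).
Local Notation mu := (@lebesgue_measure R).
Implicit Types (f g h : R -> R[i]) (t : R).

Lemma continuous_even_extension (u : R -> R) :
  {within `[0, +oo[, continuous u} -> continuous (fun x : R => u `|x|).
Proof.
move=> /continuous_within_itvcyP[cu u0] x; have [->|x0] := eqVneq x 0; last first.
  apply: (@continuous_comp _ _ _ (fun x : R => `|x|) u).
    exact: norm_continuous.
  by apply: cu; rewrite in_itv/= andbT normr_gt0.
rewrite /continuous_at normr0; apply/cvgrPdist_lt => e e0.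
move/cvgrPdist_lt : u0 => /(_ e e0) [d /= d0 dP].
apply/nbhs_ballP; exists d => // y; rewrite /ball/= sub0r normrN => yd.
have [->|y0] := eqVneq y 0; first by rewrite normr0 subrr normr0.
by apply: dP; rewrite /= ?sub0r ?normrN ?normr_id// normr_gt0.
Qed.

(** The real and imaginary parts may carry different exponents on the right
    side; lowering them to the minimum gives one factor for both. *)
Lemma Cm1P f : Cm1 K f <-> Ccm1 f /\ forall t, 0 < t -> is_scalar K (f t).
Proof.
split.
  move=> [p [p1 [f1 [[cr ci] f1K fE]]]]; split.
    split; exists p.
      exists (fun x => Re_fun f1 `|x|); split => //.
        exact: continuous_even_extension.
      move=> t t0; rewrite /Re_fun fE// complex_ReM /= (gtr0_norm t0).
      by rewrite mul0r subr0.
    exists (fun x => Im_fun f1 `|x|); split => //.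
      exact: continuous_even_extension.
    move=> t t0; rewrite /Im_fun fE// complex_ImM /= (gtr0_norm t0).
    by rewrite mul0r addr0.
  move=> t t0; have := f1K t (ltW t0); rewrite fE//; case: K => //= ft.
  by rewrite complex_ImM /= ft mul0r mulr0 addr0.
move=> [[[p [u [p1 cu uE]]] [q [v [q1 cv vE]]]] fK].
have rp : Num.min p q <= p by rewrite ge_min lexx.
have rq : Num.min p q <= q by rewrite ge_min lexx orbT.
have [u2 cu2 u2E] := Rcm1_weaken rp cu uE.
have [v2 cv2 v2E] := Rcm1_weaken rq cv vE.
exists (Num.min p q); split; first by rewrite lt_min p1 q1.
(* For real scalars the imaginary part of the factor is only known to vanish
   for positive arguments; it must be replaced to vanish at zero too. *)
exists (fun x => u2 x +i* (if K is RealScalars then 0 else v2 x)); split.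
- split; apply: continuous_subspaceT => //.
  by case: K {fK} => // x; exact: cvg_cst.
- by case: K {fK}.
- move=> t t0; apply: eq_complexP.
    by rewrite complex_ReM /= mul0r subr0 -u2E.
  rewrite complex_ImM /= mul0r addr0.
  by move: (fK t t0); case: K {fK} => /= [->|_]; rewrite ?mulr0// -v2E.
Qed.

Lemma Cm1_Ccm1 f : Cm1 K f -> Ccm1 f.
Proof. by move=> /Cm1P[]. Qed.

Lemma eq_Cm1 f g : (forall t, 0 < t -> f t = g t) -> Cm1 K f -> Cm1 K g.
Proof.
move=> fg /Cm1P[fC fK]; apply/Cm1P; split; first exact: eq_Ccm1 fC.
by move=> t t0; rewrite -fg//; exact: fK.
Qed.

Lemma Cm1N f : Cm1 K f -> Cm1 K (fun t => - f t).
Proof.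
move=> /Cm1P[fC fK]; apply/Cm1P; split; first exact: Ccm1N.
move=> t t0; move: (fK t t0); case: K {fK} => //=.
by case: (f t) => a b /= ->; rewrite oppr0.
Qed.

Lemma Cm1B f g : Cm1 K f -> Cm1 K g -> Cm1 K (fun t => f t - g t).
Proof.
move=> /Cm1P[fC fK] /Cm1P[gC gK]; apply/Cm1P; split; first exact: Ccm1B.
move=> t t0; move: (fK t t0) (gK t t0); case: K {fK gK} => //=.
by case: (f t) => a b; case: (g t) => c d /= -> ->; rewrite subr0.
Qed.

Lemma Cm1_lconv f g : Cm1 K f -> Cm1 K g -> Cm1 K (lconv f g).
Proof.
move=> /Cm1P[fC fK] /Cm1P[gC gK]; apply/Cm1P; split; first exact: Ccm1_lconv.
move=> t _; move: fK gK; case: K => //= fK gK.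
transitivity (\int[mu]_(x in `]0, t[) (0 : R)).
  apply: eq_Rintegral => x; rewrite inE/= in_itv/= => /andP[x0 xt].
  by rewrite /Im_fun complex_ImM fK ?subr_gt0// gK// mulr0 mul0r addr0.
by rewrite Rintegral_cst// mul0r.
Qed.

End function_class.

(** * Fractions with denominator kappa and the projector *)

Section quotient_field.
Context {R : realType} (K : scalars) (n : nat) (kappa k : R -> R[i]).
Hypotheses (n_gt0 : (0 < n)%N) (kappa_k : Ln K n (kappa, k)).
Implicit Types (f g h : R -> R[i]) (t : R) (q : fpair R).
Local Notation h_ := (@hfun R).

Let kappaK : Cm1 K kappa. Proof. by case: kappa_k. Qed.

Let kappaC : Ccm1 kappa. Proof. exact: Cm1_Ccm1 kappaK. Qed.

Lemma Cm10_Ccm1 f : Cm10 K f -> Ccm1 f.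
Proof.
by move=> [p [/andP[p1 _] fp]]; apply: (@Cm1_Ccm1 R K); exists p.
Qed.

Let kC : Ccm1 k. Proof. by case: kappa_k => _ /Cm10_Ccm1. Qed.

Lemma lconv_kappa_k f : Ccm1 f ->
  lconv kappa (lconv k f) = lconv (h_ n) f.
Proof.
move=> fC; rewrite -lconvA//; apply: eq_lconv => // t t0.
by case: kappa_k => _ _ ->.
Qed.

Lemma lconv_hfun_inj f g : Ccm1 f -> Ccm1 g ->
  (forall t, 0 < t -> lconv (h_ n) f t = lconv (h_ n) g t) ->
  forall t, 0 < t -> f t = g t.
Proof.
move=> fC gC fg.
exact: (is_nth_deriv_unique fg (is_nth_deriv_lconv n_gt0 fC)
         (is_nth_deriv_lconv n_gt0 gC)).
Qed.

(** Convolving with [k] replaces [kappa] by [h_n], and [h_n * f] determines [f]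
    as its n-th derivative. *)
Lemma lconv_kappa_inj f g : Ccm1 f -> Ccm1 g ->
  lconv kappa f = lconv kappa g -> forall t, 0 < t -> f t = g t.
Proof.
move=> fC gC fg; apply: lconv_hfun_inj => // t _.
by rewrite -(lconv_kappa_k fC) -(lconv_kappa_k gC)
  (lconvCA kappaC kC fC) (lconvCA kappaC kC gC) fg.
Qed.

Lemma hfun_neq0 m t : 0 < t -> h_ m t != 0.
Proof.
move=> t0; apply/eqP => /(congr1 (@complex.Re R)) /= /eqP.
by rewrite gt_eqF// divr_gt0 ?exprn_gt0// ltr0n fact_gt0.
Qed.

Lemma lconv_kappa_neq0 f : Ccm1 f -> (exists t, 0 < t /\ f t != 0) ->
  exists t, 0 < t /\ lconv f kappa t != 0.
Proof.
move=> fC [s [s0 fs]]; apply: contrapT => H; move/eqP : fs; apply.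
apply: (@lconv_kappa_inj f (fun=> 0)) => //; first exact: Ccm1_0.
rewrite lconvC//; apply: lconv_ext => t t0.
transitivity (0 : R[i]).
  by apply/eqP/negP => /negP ft; apply: H; exists t.
transitivity (lconv kappa (fun x => 0 * kappa x) t).
  by rewrite lconvZr// mul0r.
by congr (_ t); apply: eq_lconv => // x _; rewrite mul0r.
Qed.

(** Otherwise [kappa * k] would vanish, whereas [h_n] does not. *)
Lemma kappa_neq0 : exists t, 0 < t /\ kappa t != 0.
Proof.
apply: contrapT => H.
have k0 t : 0 < t -> kappa t = 0 * kappa t.
  by move=> t0; apply/eqP/negP => /negP kt; apply: H; exists t; rewrite mul0r in kt.
have := hfun_neq0 n (@ltr01 R).
case: kappa_k => _ _ /= <-//; rewrite lconvC// => /eqP; apply.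
transitivity (lconv k (fun x => 0 * kappa x) 1).
  by congr (_ 1); apply: eq_lconv.
by rewrite lconvZr// mul0r.
Qed.

Lemma cq_equivP (p q : fpair R) :
  cq_equiv p q <-> lconv p.1 q.2 = lconv q.1 p.2.
Proof. by split=> [/lconv_ext//|pq t _]; rewrite pq. Qed.

Lemma cq_pair_kappa f : Cm1 K f -> cq_pair K (f, kappa).
Proof. by move=> fK; split => //=; exact: kappa_neq0. Qed.

Lemma cq_pairC q : cq_pair K q -> Ccm1 q.1 /\ Ccm1 q.2.
Proof. by case=> /Cm1_Ccm1 ? /Cm1_Ccm1 ?. Qed.

Lemma cq_embedE f : Cm1 K f -> cq_embed K kappa f = cq_frac K (lconv kappa f) kappa.
Proof. by move=> fK; rewrite /cq_embed lconvC//; exact: Cm1_Ccm1 fK. Qed.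

Lemma mem_cq_frac f : Cm1 K f -> cq_frac K f kappa (f, kappa).
Proof. by move=> fK; split; [exact: cq_pair_kappa|move=> t _]. Qed.

(** Representatives [a] of [S_kappa] satisfy [a.2 = a.1 * kappa] and those [b] of
    [f] satisfy [b.1 = f * b.2], by cancelling [kappa].  Hence the product of any
    two representatives is equivalent to [f / kappa], and testing against the
    particular representatives [kappa / (kappa * kappa)] and
    [(f * kappa) / kappa] is enough for the other inclusion. *)
Lemma cq_mul_S_embed f : Cm1 K f ->
  cq_mul K (cq_S K kappa) (cq_embed K kappa f) = cq_frac K f kappa.
Proof.
move=> fK; have fC := Cm1_Ccm1 fK.
apply/seteqP; split => q [qP qE]; (split; first exact: qP);
  have [q1C q2C] := cq_pairC qP.
  have S1 : cq_S K kappa (kappa, lconv kappa kappa).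
    split; last by move=> t _.
    split => //=; first exact: Cm1_lconv.
    exact: (lconv_kappa_neq0 kappaC kappa_neq0).
  have f1 : cq_embed K kappa f (lconv f kappa, kappa).
    by apply: mem_cq_frac; exact: Cm1_lconv.
  move/cq_equivP : (qE _ _ S1 f1) => /= E; apply/cq_equivP => /=.
  have qkC := Ccm1_lconv q1C kappaC; have fqC := Ccm1_lconv fC q2C.
  have kkC := Ccm1_lconv kappaC kappaC; have fkC := Ccm1_lconv fC kappaC.
  apply: lconv_ext; apply: (lconv_kappa_inj qkC fqC).
  apply: lconv_ext; apply: lconv_kappa_inj; [exact: Ccm1_lconv..|].
  transitivity (lconv q.1 (lconv (lconv kappa kappa) kappa)).
    rewrite (lconvA kappaC kappaC kappaC) (lconvCA q1C kappaC kkC).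
    by rewrite (lconvCA q1C kappaC kappaC).
  rewrite E (lconvA kappaC fkC q2C) (lconvAC fC kappaC q2C); congr lconv.
  by rewrite (lconvC fqC kappaC).
move/cq_equivP : qE => /= qE a b [aP /cq_equivP/= aE] [bP /cq_equivP/= bE].
have [a1C a2C] := cq_pairC aP; have [b1C b2C] := cq_pairC bP.
have akC := Ccm1_lconv a1C kappaC; have fb2C := Ccm1_lconv fC b2C.
have a2E t : 0 < t -> a.2 t = lconv a.1 kappa t.
  move: t; apply: (lconv_kappa_inj a2C akC).
  by rewrite -aE (lconvCA kappaC a1C kappaC).
have b1E t : 0 < t -> b.1 t = lconv f b.2 t.
  move: t; apply: (lconv_kappa_inj b1C fb2C).
  by rewrite (lconvC kappaC b1C) bE (lconvAC fC kappaC b2C) lconvC.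
apply/cq_equivP => /=.
rewrite (eq_lconv a2E (fun t _ => erefl (b.2 t))).
rewrite (eq_lconv (fun t _ => erefl (a.1 t)) b1E).
have kb2C := Ccm1_lconv kappaC b2C; have a1b2C := Ccm1_lconv a1C b2C.
rewrite (lconvA a1C kappaC b2C) (lconvA a1C fb2C q2C) (lconvCA q1C a1C kb2C).
by rewrite -(lconvA q1C kappaC b2C) qE (lconvAC fC q2C b2C).
Qed.

Lemma cq_opp_frac f : Cm1 K f ->
  cq_opp K (cq_frac K f kappa) = cq_frac K (fun t => - f t) kappa.
Proof.
move=> fK; have fC := Cm1_Ccm1 fK.
have fNC := Ccm1N fC.
apply/seteqP; split => q [qP qE]; (split; first exact: qP).
  exact: (qE _ (mem_cq_frac fK)).
have [q1C q2C] := cq_pairC qP.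
move/cq_equivP : qE => /= qE a [aP /cq_equivP/= aE].
have [a1C a2C] := cq_pairC aP; have a1N := Ccm1N a1C.
apply/cq_equivP => /=.
apply: lconv_ext; apply: lconv_kappa_inj; [exact: Ccm1_lconv|exact: Ccm1_lconv|].
have [fq2C fa2C] := (Ccm1_lconv fC q2C, Ccm1_lconv fC a2C).
rewrite -(lconvA kappaC q1C a2C) -(lconvA kappaC a1N q2C) (lconvC kappaC q1C).
rewrite qE (lconvC kappaC a1N) (lconvNl kappaC a1C) aE (lconvNl q2C fC).
by rewrite (lconvNl a2C fq2C) (lconvNl q2C fa2C) (lconvAC fC q2C a2C).
Qed.

(** As for products: one inclusion is the test against [f / kappa] and
    [g / kappa]; the other one multiplies the required equation by [kappa] in
    order to use the equations of the representatives. *)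
Lemma cq_add_frac f g : Cm1 K f -> Cm1 K g ->
  cq_add K (cq_frac K f kappa) (cq_frac K g kappa) =
  cq_frac K (fun t => f t + g t) kappa.
Proof.
move=> fK gK; have fC := Cm1_Ccm1 fK; have gC := Cm1_Ccm1 gK.
have fgC := Ccm1D fC gC.
apply/seteqP; split => q [qP qE]; (split; first exact: qP);
  have [q1C q2C] := cq_pairC qP.
  move/cq_equivP : (qE _ _ (mem_cq_frac fK) (mem_cq_frac gK)) => /=.
  rewrite -(lconvDl kappaC fC gC) => E; apply/cq_equivP => /=.
  have fgq2C := Ccm1_lconv fgC q2C.
  apply: lconv_ext; apply: (lconv_kappa_inj (Ccm1_lconv q1C kappaC) fgq2C).
  rewrite (lconvCA kappaC q1C kappaC) E (lconvAC fgC kappaC q2C).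
  exact: (lconvC fgq2C kappaC).
move/cq_equivP : qE => /= qE a b [aP /cq_equivP/= aE] [bP /cq_equivP/= bE].
have [a1C a2C] := cq_pairC aP; have [b1C b2C] := cq_pairC bP.
have abC := Ccm1_lconv a2C b2C.
have a1b2C := Ccm1_lconv a1C b2C; have b1a2C := Ccm1_lconv b1C a2C.
pose s t := lconv a.1 b.2 t + lconv b.1 a.2 t.
have sC : Ccm1 s by exact: Ccm1D.
have kappa_a : lconv kappa (lconv a.1 b.2) = lconv f (lconv a.2 b.2).
  by rewrite -(lconvA fC a2C b2C) -aE -(lconvA kappaC a1C b2C) (lconvC kappaC a1C).
have kappa_b : lconv kappa (lconv b.1 a.2) = lconv g (lconv a.2 b.2).
  rewrite (lconvC a2C b2C) -(lconvA gC b2C a2C) -bE -(lconvA kappaC b1C a2C).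
  by rewrite (lconvC kappaC b1C).
have kappa_s : lconv kappa s = lconv (fun t => f t + g t) (lconv a.2 b.2).
  by rewrite (lconvDr kappaC a1b2C b1a2C) (lconvDl abC fC gC) kappa_a kappa_b.
apply/cq_equivP; rewrite /= -/s.
apply: lconv_ext.
apply: (lconv_kappa_inj (Ccm1_lconv q1C abC) (Ccm1_lconv sC q2C)).
transitivity (lconv (lconv kappa s) q.2); last exact: (lconvA kappaC sC q2C).
rewrite kappa_s -(lconvA kappaC q1C abC) (lconvC kappaC q1C) qE.
exact: (lconvAC fgC q2C abC).
Qed.

Lemma eq_cq_frac f g : (forall t, 0 < t -> f t = g t) ->
  cq_frac K f kappa = cq_frac K g kappa.
Proof.
move=> fg; rewrite /cq_frac; apply/seteqP; split => q [qP /cq_equivP/= qE];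
  (split; first exact: qP); apply/cq_equivP => /=; rewrite qE;
  by apply: eq_lconv => // t t0; rewrite fg.
Qed.

(** The two sides are n-th derivatives of one function on [t > 0], namely
    [h_n * (f - kappa * D f) = \sum_i c_i (h_(i+1) * kappa)]. *)
Lemma projectorE f : Cm1_deriv K n.-1 kappa -> gfd_RL_domain K n k f ->
  forall t, 0 < t ->
    f t - lconv kappa (gfd_RL n k f) t = projector n kappa k f t.
Proof.
move=> [_ kd _] [fK gd DK].
have fC := Cm1_Ccm1 fK; have DC := Cm1_Ccm1 DK.
have hC := @Ccm1_hfun R.
pose c (i : 'I_n) := climit0 (cderiven i (lconv k f)).
set u := fun t => f t - lconv kappa (gfd_RL n k f) t.
have uC : Ccm1 u by apply: Ccm1B => //; exact: Ccm1_lconv.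
have T := taylor_at0 n_gt0 gd DC.
have cH : Ccm1 (fun t => \sum_(i < n) c i * h_ i.+1 t).
  by apply: (@Ccm1_sum _ _ (fun i t => c i * h_ i.+1 t)) => i; apply: Ccm1Z; exact: hC.
have E : forall t, 0 < t -> lconv (h_ n) u t =
    \sum_(i < n) c i * lconv (h_ i.+1) kappa t.
  move=> t t0; rewrite lconvBr//; last exact: Ccm1_lconv.
  rewrite -(lconv_kappa_k fC) (eq_lconv (fun t _ => erefl (kappa t)) T).
  rewrite lconvDr//; last by exact: Ccm1_lconv.
  rewrite (lconvCA kappaC (hC n) DC) addrK.
  rewrite (lconv_sumr c kappaC (fun i : 'I_n => hC i.+1)).
  by apply: eq_bigr => i _; rewrite (lconvC kappaC (hC i.+1)).
apply: (is_nth_deriv_unique E (is_nth_deriv_lconv n_gt0 uC)).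
apply: (@is_nth_deriv_sum _ _ _ c (fun i => lconv (h_ i.+1) kappa)
  (fun i => cderiven (n.-1 - i) kappa)) => i.
(* The first i + 1 derivatives remove h_(i+1), the others fall on kappa. *)
have nE : (i.+1 + (n.-1 - i))%N = n by have := ltn_ord i; lia.
have kappaD : is_nth_deriv (n.-1 - i) kappa (cderiven (n.-1 - i) kappa).
  by apply: is_nth_deriv_cderiven; apply: cderivablenW kd; exact: leq_subr.
have := is_nth_deriv_comp (is_nth_deriv_lconv (ltn0Sn i) kappaC) kappaD.
by rewrite nE.
Qed.

End quotient_field.

Theorem theorem3p3 (R : realType) (K : scalars) (n : nat)
    (kappa k f : R -> R[i])
    (n_gt0 : (0 < n)%N)
    (kappa_k : Ln K n (kappa, k))
    (kappa_smooth : Cm1_deriv K n.-1 kappa)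
    (f_dom : gfd_RL_domain K n k f) :
  Cm1 K (projector n kappa k f) /\
  cq_embed K kappa (gfd_RL n k f) =
    cq_sub K
      (cq_mul K (cq_S K kappa) (cq_embed K kappa f))
      (cq_mul K (cq_S K kappa) (cq_embed K kappa (projector n kappa k f))).
Proof.
have FE := projectorE n_gt0 kappa_k kappa_smooth f_dom.
have [kappaK _ _] := kappa_k; have [fK _ DK] := f_dom.
have FK : Cm1 K (projector n kappa k f).
  by apply: eq_Cm1 FE _; apply: Cm1B => //; exact: Cm1_lconv.
split => //.
rewrite /cq_sub (cq_mul_S_embed n_gt0 kappa_k fK) (cq_mul_S_embed n_gt0 kappa_k FK).
rewrite (cq_opp_frac n_gt0 kappa_k FK).
rewrite (cq_add_frac n_gt0 kappa_k fK (Cm1N FK)).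
rewrite (cq_embedE kappa_k DK); apply: eq_cq_frac => t t0.
by rewrite -FE// opprB addrC subrK.
Qed.
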